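(* Let $\Gamma$ be a metric circle. Let $W$ be a parabolic subgroup of type $\prod_{i=1}^kA_{n_i-1}$ of the Weyl group $W'$ of a root datum $\Phi=(M,R,\check M,\check R)$. Let $G'=\check M_{\mathbb R}\rtimes W'$ be the tropical reductive group associated to $\Phi$ and let $G=\check M_{\mathbb R}\rtimes W$. Then the natural map $$\mathcal M_{G,\mathrm{ind}}(\Gamma)/\big(N_{W'}(W)/W\big)\longrightarrow\mathcal M_{G',\mathrm{ind}_{W'}}(\Gamma)$$ is a bijection.
   Context: A metric circle is $\Gamma=\mathbb R/\ell\mathbb Z$. $\mathcal H_\Gamma$ is the sheaf of harmonic functions on $\Gamma$ (continuous piecewise linear with integer slopes, outgoing slopes at each point summing to zero). For $G=\check M_{\mathbb R}\rtimes W$, a $G$-bundle is a torsor under $(\check M\otimes_{\mathbb Z}\mathcal H_\Gamma)\rtimes W$; it has an associated $W$-torsor. For a $W$-torsor $\tau$, $\mathcal M_{G,\tau}(\Gamma)$ is the set of isomorphism classes of $G$-bundles whose associated $W$-torsor is isomorphic to $\tau$; similarly for $G'$ and $W'$. $W$-torsors on $\Gamma$ up to isomorphism correspond to conjugacy classes in $W$ (monodromy). With $W\cong\prod_iS_{n_i}$ (as a Coxeter group), $\mathrm{ind}$ is the indecomposable $W$-torsor, whose monodromy is a product of an $n_i$-cycle in each factor, and $\mathrm{ind}_{W'}$ is the $W'$-torsor induced from it by $W\subseteq W'$. A parabolic subgroup of $W'$ is a conjugate of a subgroup generated by a subset of the simple reflections. $N_{W'}(W)$ acts on $G$ by conjugation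 inside $G'$ and hence on the set of isomorphism classes of $G$-bundles; $W$ acts trivially and $\mathcal M_{G,\mathrm{ind}}(\Gamma)$ is preserved, giving the action of $N_{W'}(W)/W$. The natural map sends a $G$-bundle to the $G'$-bundle induced along $G\hookrightarrow G'$. *)

(* Defs.v *)
From HB Require Import structures.
From mathcomp Require Import all_boot all_order all_algebra all_fingroup.
From mathcomp Require Import all_classical all_reals all_analysis.

Set Implicit Arguments.
Unset Strict Implicit.
Unset Printing Implicit Defensive.

Import Order.TTheory GRing.Theory Num.Theory.
Import numFieldNormedType.Exports.

Local Open Scope classical_set_scope.
Local Open Scope ring_scope.
Local Open Scope quotient_scope.

Identity Coercion fun_of_set : set >-> Funclass.

Record opens (X : topologicalType) := Opens {
  opens_set :> set X;
  opensP : open opens_set }.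

Definition pts (X : topologicalType) (U : opens X) : Type := {x : X | U x}.

Definition incl (X : topologicalType) (U V : opens X) (h : V `<=` U)
  (x : pts V) : pts U := exist _ (sval x) (h _ (proj2_sig x)).

Record sheaf (X : topologicalType) := Sheaf {
  sect :> opens X -> Type;
  res : forall U V : opens X, V `<=` U -> sect U -> sect V;
  res_id : forall (U : opens X) (h : U `<=` U) s, res h s = s;
  res_comp : forall (U V Z : opens X) (hV : V `<=` U) (hZ : Z `<=` V)
    (h : Z `<=` U) s, res hZ (res hV s) = res h s;
  glue : forall (U : opens X) (I : Type) (V : I -> opens X)
    (hV : forall i, V i `<=` U), (forall x, U x -> exists i, V i x) ->
    forall s : forall i, sect (V i),
    (forall i j (Z : opens X) (hi : Z `<=` V i) (hj : Z `<=` V j),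
       res hi (s i) = res hj (s j)) ->
    exists! t : sect U, forall i, res (hV i) t = s i }.

Record group_sheaf (X : topologicalType) := GroupSheaf {
  gsheaf :> sheaf X;
  gone : forall U : opens X, gsheaf U;
  gmul : forall U : opens X, gsheaf U -> gsheaf U -> gsheaf U;
  ginv : forall U : opens X, gsheaf U -> gsheaf U;
  gmulA : forall U (a b c : gsheaf U), gmul a (gmul b c) = gmul (gmul a b) c;
  gmul1 : forall U (a : gsheaf U), gmul (gone U) a = a;
  gmulV : forall U (a : gsheaf U), gmul (ginv a) a = gone U;
  res_gmul : forall (U V : opens X) (h : V `<=` U) (a b : gsheaf U),
    res h (gmul a b) = gmul (res h a) (res h b) }.

Record gsheaf_hom (X : topologicalType) (G H : group_sheaf X) := GsheafHom {
  hom_fun :> forall U : opens X, G U -> H U;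
  hom_mul : forall U (a b : G U),
    hom_fun (gmul a b) = gmul (hom_fun a) (hom_fun b);
  hom_res : forall (U V : opens X) (h : V `<=` U) (a : G U),
    hom_fun (res h a) = res h (hom_fun a) }.

(* Torsors are for right actions. *)

Record torsor (X : topologicalType) (G : group_sheaf X) := Torsor {
  tsheaf :> sheaf X;
  act : forall U : opens X, tsheaf U -> G U -> tsheaf U;
  act_one : forall U (p : tsheaf U), act p (gone G U) = p;
  act_mul : forall U (p : tsheaf U) (a b : G U),
    act (act p a) b = act p (gmul a b);
  act_res : forall (U V : opens X) (h : V `<=` U) (p : tsheaf U) (a : G U),
    res h (act p a) = act (res h p) (res h a);
  act_simply_transitive : forall U (p q : tsheaf U), exists! a, act p a = q;
  locally_nonempty : forall x : X,
    exists2 U : opens X, U x & exists p : tsheaf U, True }.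

Definition torsor_iso (X : topologicalType) (G : group_sheaf X)
    (P Q : torsor G) : Prop :=
  exists f : forall U : opens X, P U -> Q U,
    [/\ forall U, bijective (f U),
        forall (U V : opens X) (h : V `<=` U) (p : P U),
          f V (res h p) = res h (f U p)
      & forall U (p : P U) (a : G U), f U (act p a) = act (f U p) a].

Definition opens_setI (X : topologicalType) (U V : opens X) : opens X :=
  Opens (openI (opensP U) (opensP V)).

Section GroupSheafTheory.
Variables (X : topologicalType) (G : group_sheaf X).
Implicit Types U V : opens X.

Lemma gmulI U (a b c : G U) : gmul a b = gmul a c -> b = c.
Proof.
by move=> /(congr1 (gmul (ginv a))); rewrite !gmulA gmulV !gmul1.
Qed.

Lemma gmulr1 U (a : G U) : gmul a (gone G U) = a.
Proof.
by apply: (@gmulI U (ginv a)); rewrite gmulA gmulV gmul1.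
Qed.

Lemma gmulrV U (a : G U) : gmul a (ginv a) = gone G U.
Proof.
by apply: (@gmulI U (ginv a)); rewrite gmulA gmulV gmul1 gmulr1.
Qed.

Lemma gidem U (a : G U) : gmul a a = a -> a = gone G U.
Proof. by move=> h; apply: (@gmulI U a); rewrite h gmulr1. Qed.

Lemma ginv_uniq U (a b : G U) : gmul b a = gone G U -> b = ginv a.
Proof.
by move=> h; rewrite -[b]gmulr1 -(gmulrV a) gmulA h gmul1.
Qed.

Lemma ginvM U (a b : G U) : ginv (gmul a b) = gmul (ginv b) (ginv a).
Proof.
apply: esym; apply: ginv_uniq.
by rewrite -gmulA (gmulA (ginv a)) gmulV gmul1 gmulV.
Qed.

Lemma res_gone U V (h : V `<=` U) : res h (gone G U) = gone G V.
Proof. by apply: gidem; rewrite -res_gmul gmul1. Qed.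

Lemma res_ginv U V (h : V `<=` U) (a : G U) : res h (ginv a) = ginv (res h a).
Proof. by apply: ginv_uniq; rewrite -res_gmul gmulV res_gone. Qed.

End GroupSheafTheory.

Lemma hom_one (X : topologicalType) (G H : group_sheaf X)
  (f : gsheaf_hom G H) (U : opens X) :
  f U (gone G U) = gone H U.
Proof. by apply: gidem; rewrite -hom_mul gmul1. Qed.

Lemma hom_inv (X : topologicalType) (G H : group_sheaf X)
  (f : gsheaf_hom G H) (U : opens X) (a : G U) :
  f U (ginv a) = ginv (f U a).
Proof. by apply: ginv_uniq; rewrite -hom_mul gmulV hom_one. Qed.

Lemma sheaf_sep (X : topologicalType) (F : sheaf X) (U : opens X) (s t : F U) :
  (forall x, U x -> exists2 V : opens X, V x &
     exists h : V `<=` U, res h s = res h t) -> s = t.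
Proof.
move=> loc.
pose I := {V : opens X | exists h : V `<=` U, res h s = res h t}.
have hV (i : I) : sval i `<=` U by case: (svalP i).
have cov x : U x -> exists i : I, sval i x.
  by move=> /loc[V Vx hV']; exists (exist _ V hV').
have [|u [_ uu]] := glue hV cov (s := fun i => res (hV i) s).
  move=> i j Z hi hj.
  have h : Z `<=` U by apply: subset_trans (hV i).
  by rewrite (res_comp _ _ h) (res_comp _ _ h).
rewrite -(uu s) // -(uu t) // => i.
case: (svalP i) => h; rewrite (Prop_irrelevance h (hV i)) => ->//.
Qed.

Section TorsorTheory.
Variables (X : topologicalType) (G : group_sheaf X).
Implicit Types (U V : opens X) (P Q : torsor G).

Lemma act_inj P U (p : P U) (a b : G U) : act p a = act p b -> a = b.
Proof.
have [c [hc uc]] := act_simply_transitive p (act p b).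
by move=> e; rewrite -(uc a) // -(uc b).
Qed.

(* [torsor_div p q] is the unique [a] with [p a = q]. *)
Definition torsor_div P U (p q : P U) : G U :=
  sval (cid (act_simply_transitive p q)).

Lemma torsor_divP P U (p q : P U) : act p (torsor_div p q) = q.
Proof. by rewrite /torsor_div; case: cid => a []. Qed.

Lemma torsor_div_uniq P U (p q : P U) a : act p a = q -> torsor_div p q = a.
Proof. by move=> e; apply: (@act_inj _ _ p); rewrite torsor_divP. Qed.

Lemma res_torsor_div P U V (h : V `<=` U) (p q : P U) :
  res h (torsor_div p q) = torsor_div (res h p) (res h q).
Proof. by apply: esym; apply: torsor_div_uniq; rewrite -act_res torsor_divP. Qed.

Lemma torsor_iso_of_map P Q (f : forall U, P U -> Q U) :
  (forall U V (h : V `<=` U) (p : P U), f V (res h p) = res h (f U p)) ->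
  (forall U (p : P U) (a : G U), f U (act p a) = act (f U p) a) ->
  torsor_iso P Q.
Proof.
move=> fr fa; exists f; split => // U.
have finj V : injective (f V).
  move=> p p' e; rewrite -[p](act_one p) -[p'](torsor_divP p p').
  congr act; apply: esym; apply: torsor_div_uniq.
  apply: esym.
  have : act (f V p) (torsor_div p p') = act (f V p) (gone G V).
    by rewrite -fa torsor_divP -e act_one.
  by move=> /act_inj <-; rewrite torsor_divP.
suff fsur q : exists p, f U p = q.
  have [g gK] := choice fsur.
  by exists g => // p; apply: finj; rewrite gK.
pose I := {V : opens X | V `<=` U /\ exists p : P V, True}.
have hV (i : I) : sval i `<=` U by case: (svalP i).
pose p0 (i : I) : P (sval i) := sval (cid (svalP i).2).
pose p (i : I) := act (p0 i) (torsor_div (f _ (p0 i)) (res (hV i) q)).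
have fp i : f _ (p i) = res (hV i) q by rewrite fa torsor_divP.
have cov x : U x -> exists i : I, sval i x.
  move=> Ux; have [V Vx [r _]] := @locally_nonempty _ _ P x.
  have h1 : opens_setI U V `<=` U by move=> y [].
  have h2 : opens_setI U V `<=` V by move=> y [].
  by exists (exist _ (opens_setI U V)
    (conj h1 (ex_intro _ (res h2 r) Logic.I))).
have [|t [ht _]] := glue hV cov (s := p).
  move=> i j Z hi hj; apply: finj; have h := subset_trans hi (hV i).
  by rewrite !fr !fp (res_comp _ _ h) (res_comp _ _ h).
exists t; apply: sheaf_sep => x /cov[i ix].
by exists (sval i) => //; exists (hV i); rewrite -fr ht fp.
Qed.

End TorsorTheory.

(* A section over [U] of the contracted product [(P x H) / G], the quotient by
   [(p a, b) ~ (p, phi(a) b)], is encoded as the morphism [psi : P|_U -> H|_U]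
   taking [p] to the unique [psi p] such that the section is the class of
   [(p, psi p)]; thus [psi (p a) = phi(a)^-1 (psi p)]. By [induce_map] the
   result receives a [phi]-equivariant morphism from [P], and by [induce_uniq]
   this characterizes it up to isomorphism. *)
Section Induce.
Variables (X : topologicalType) (G H : group_sheaf X) (phi : gsheaf_hom G H).
Variable P : torsor G.
Implicit Types U V Z : opens X.

Record induced_sect (U : opens X) := InducedSect {
  ev :> forall V : opens X, V `<=` U -> P V -> H V;
  ev_res : forall (V Z : opens X) (hV : V `<=` U) (hZ : Z `<=` U)
    (h : Z `<=` V) (p : P V), ev hZ (res h p) = res h (ev hV p);
  ev_act : forall (V : opens X) (hV : V `<=` U) (p : P V) (a : G V),
    ev hV (act p a) = gmul (ginv (phi V a)) (ev hV p) }.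

Lemma induced_sect_eq U (s t : induced_sect U) :
  (forall V (hV : V `<=` U) (p : P V), s V hV p = t V hV p) -> s = t.
Proof.
case: s t => [s s1 s2] [t t1 t2] /= st.
have e : s = t.
  apply: functional_extensionality_dep => V.
  apply: functional_extensionality_dep => hV.
  by apply: functional_extensionality_dep => p; apply: st.
by subst t; congr InducedSect; apply: Prop_irrelevance.
Qed.

Definition induced_res U V (h : V `<=` U) (s : induced_sect U) :
  induced_sect V.
Proof.
exists (fun Z (hZ : Z `<=` V) p => s Z (subset_trans hZ h) p).
- by move=> *; apply: ev_res.
- by move=> *; apply: ev_act.
Defined.

Lemma induced_glue U (I : Type) (V : I -> opens X)
  (hV : forall i, V i `<=` U) : (forall x, U x -> exists i, V i x) ->
  forall s : forall i, induced_sect (V i),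
  (forall i j Z (hi : Z `<=` V i) (hj : Z `<=` V j),
     induced_res hi (s i) = induced_res hj (s j)) ->
  exists! t : induced_sect U, forall i, induced_res (hV i) t = s i.
Proof.
move=> cov s comp.
have cmp i j Z (hi : Z `<=` V i) (hj : Z `<=` V j) p :
    s i Z hi p = s j Z hj p.
  have /(congr1 (fun t : induced_sect Z => t Z (@subset_refl _ Z) p)) :=
    comp i j Z hi hj.
  by rewrite /= (Prop_irrelevance (subset_trans _ hi) hi)
    (Prop_irrelevance (subset_trans _ hj) hj).
have hI1 Z i : opens_setI Z (V i) `<=` Z by move=> x [].
have hI2 Z i : opens_setI Z (V i) `<=` V i by move=> x [].
have exu Z (hZ : Z `<=` U) (p : P Z) : exists! b : H Z, forall i,
    res (hI1 Z i) b = s i _ (hI2 Z i) (res (hI1 Z i) p).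
  apply: glue.
    by move=> x Zx; have [i Vx] := cov x (hZ x Zx); exists i.
  move=> i j T hi hj.
  rewrite -(ev_res (s i) (hI2 Z i) (subset_trans hi (hI2 Z i))).
  rewrite -(ev_res (s j) (hI2 Z j) (subset_trans hj (hI2 Z j))).
  rewrite !(res_comp _ _ (subset_trans hi (hI1 Z i))).
  exact: cmp.
pose t Z hZ p := sval (cid (exu Z hZ p)).
have tP Z hZ p i : res (hI1 Z i) (t Z hZ p) =
    s i _ (hI2 Z i) (res (hI1 Z i) p).
  by have [+ _] := svalP (cid (exu Z hZ p)); apply.
have tU Z hZ p b : (forall i, res (hI1 Z i) b =
    s i _ (hI2 Z i) (res (hI1 Z i) p)) -> t Z hZ p = b.
  by move=> hb; have [_ +] := svalP (cid (exu Z hZ p)); apply.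
have t1 (Z T : opens X) (hZ : Z `<=` U) (hT : T `<=` U) (h : T `<=` Z) (p : P Z) :
    t T hT (res h p) = res h (t Z hZ p).
  apply: tU => i.
  have hTZ : opens_setI T (V i) `<=` opens_setI Z (V i).
    by move=> x [Tx Vx]; split => //; apply: h.
  have hTZ' := subset_trans hTZ (hI1 Z i).
  rewrite (res_comp _ _ hTZ') (res_comp _ _ hTZ').
  rewrite -(res_comp (hI1 Z i) hTZ hTZ') tP.
  by rewrite -(ev_res _ _ (hI2 T i)) (res_comp _ _ hTZ').
have t2 Z (hZ : Z `<=` U) (p : P Z) (a : G Z) :
    t Z hZ (act p a) = gmul (ginv (phi Z a)) (t Z hZ p).
  apply: tU => i.
  by rewrite res_gmul tP act_res ev_act res_ginv hom_res.
exists (InducedSect t1 t2); split.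
  move=> i; apply: induced_sect_eq => Z hZ p /=.
  apply: tU => j.
  rewrite -(ev_res (s i) hZ (subset_trans (hI1 Z j) hZ)).
  exact: cmp.
move=> u hu; apply: induced_sect_eq => Z hZ p /=.
apply: tU => i.
rewrite -(hu i) /=.
by apply: esym; apply: ev_res.
Qed.

Definition induced_sheaf : sheaf X.
Proof.
apply: (@Sheaf X induced_sect induced_res).
- move=> U h s; apply: induced_sect_eq => V hV p /=.
  by congr (ev s _ p); apply: Prop_irrelevance.
- move=> U V Z hV hZ h s; apply: induced_sect_eq => T hT p /=.
  by congr (ev s _ p); apply: Prop_irrelevance.
- exact: induced_glue.
Defined.

Definition induced_act U (s : induced_sect U) (b : H U) : induced_sect U.
Proof.
exists (fun V (hV : V `<=` U) p => gmul (s V hV p) (res hV b)).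
- move=> V Z hV hZ h p.
  by rewrite (ev_res s hV) res_gmul (res_comp _ _ hZ).
- by move=> V hV p a; rewrite ev_act gmulA.
Defined.

Lemma induced_simply_transitive U (s t : induced_sect U) :
  exists! b, induced_act s b = t.
Proof.
pose I := {V : opens X | V `<=` U /\ exists p : P V, True}.
have hV (i : I) : sval i `<=` U by case: (svalP i).
pose p (i : I) : P (sval i) := sval (cid (svalP i).2).
have cov x : U x -> exists i : I, sval i x.
  move=> Ux; have [V Vx [q _]] := @locally_nonempty _ _ P x.
  have h1 : opens_setI U V `<=` U by move=> y [].
  have h2 : opens_setI U V `<=` V by move=> y [].
  by exists (exist _ (opens_setI U V)
    (conj h1 (ex_intro _ (res h2 q) Logic.I))).
pose d (i : I) : H (sval i) :=
  gmul (ginv (s _ (hV i) (p i))) (t _ (hV i) (p i)).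
have dP (i : I) (Z : opens X) (hi : Z `<=` sval i) (hZ : Z `<=` U) (q : P Z) :
    res hi (d i) = gmul (ginv (s _ hZ q)) (t _ hZ q).
  rewrite /d res_gmul res_ginv -(ev_res s (hV i) hZ) -(ev_res t (hV i) hZ).
  have [a [<- _]] := act_simply_transitive (res hi (p i)) q.
  rewrite !ev_act ginvM -gmulA; congr gmul.
  by rewrite gmulA gmulV gmul1.
have [|b [hb ub]] := glue hV cov (s := d).
  move=> i j Z hi hj; have hZ := subset_trans hi (hV i).
  by rewrite (dP i Z hi hZ (res hi (p i))) (dP j Z hj hZ (res hi (p i))).
exists b; split.
  apply: induced_sect_eq => V hVU q /=.
  apply: sheaf_sep => x Vx; have [i ix] := cov x (hVU x Vx).
  exists (opens_setI V (sval i)) => //.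
  have h1 : opens_setI V (sval i) `<=` V by move=> y [].
  have h2 : opens_setI V (sval i) `<=` sval i by move=> y [].
  have h3 := subset_trans h1 hVU.
  exists h1; rewrite res_gmul (res_comp _ _ h3) -(res_comp (hV i) h2 h3) hb.
  rewrite (dP i _ h2 h3 (res h1 q)) (ev_res s hVU) (ev_res t hVU).
  by rewrite gmulA gmulrV gmul1.
move=> b' eb; apply: ub => i; rewrite /d -eb /=.
by rewrite gmulA gmulV gmul1.
Qed.

(* the class of [(p, 1)] *)
Definition induced_of U (p : P U) : induced_sect U.
Proof.
exists (fun V (hV : V `<=` U) q => ginv (phi V (torsor_div (res hV p) q))).
- move=> V Z hV hZ h q; rewrite res_ginv -hom_res; congr (ginv (phi _ _)).
  apply: (@act_inj _ _ _ _ (res hZ p)); rewrite torsor_divP.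
  by rewrite -(res_comp hV h hZ) -act_res torsor_divP.
- move=> V hV q a; rewrite -ginvM -hom_mul; congr (ginv (phi _ _)).
  by apply: (@act_inj _ _ _ _ (res hV p)); rewrite -act_mul !torsor_divP.
Defined.

Definition induce : torsor H.
Proof.
apply: (@Torsor X H induced_sheaf induced_act).
- move=> U s; apply: induced_sect_eq => V hV p /=.
  by rewrite res_gone gmulr1.
- move=> U s a b; apply: induced_sect_eq => V hV p /=.
  by rewrite res_gmul gmulA.
- move=> U V h s a; apply: induced_sect_eq => Z hZ p /=.
  by rewrite (res_comp _ _ (subset_trans hZ h)).
- exact: induced_simply_transitive.
- move=> x; have [U Ux [p _]] := @locally_nonempty _ _ P x.
  by exists U => //; exists (induced_of p).
Defined.

Definition equivariant_map (Q : torsor H) (f : forall U, P U -> Q U) : Prop :=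
  (forall U V (h : V `<=` U) (p : P U), f V (res h p) = res h (f U p)) /\
  (forall U (p : P U) (a : G U), f U (act p a) = act (f U p) (phi U a)).

Lemma induce_map : equivariant_map (Q := induce) induced_of.
Proof.
split=> [U V h p|U p a]; apply: induced_sect_eq => Z hZ q /=.
  by rewrite (res_comp _ _ (subset_trans hZ h)).
apply: esym; apply: ginv_uniq; rewrite -gmulA -hom_res -hom_mul.
rewrite -(_ : torsor_div (res hZ p) q =
    gmul (res hZ a) (torsor_div (res hZ (act p a)) q)).
  by rewrite gmulV.
apply: (@act_inj _ _ _ _ (res hZ p)).
by rewrite torsor_divP -act_mul -act_res torsor_divP.
Qed.

Lemma induce_uniq (Q : torsor H) (f : forall U, P U -> Q U) :
  equivariant_map f -> torsor_iso Q induce.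
Proof.
move=> [fr fa].
have e1 U (q : Q U) (V Z : opens X) (hV : V `<=` U) (hZ : Z `<=` U)
    (h : Z `<=` V) (p : P V) : torsor_div (f Z (res h p)) (res hZ q) =
      res h (torsor_div (f V p) (res hV q)).
  by rewrite res_torsor_div fr (res_comp _ _ hZ).
have e2 U (q : Q U) V (hV : V `<=` U) (p : P V) (a : G V) :
    torsor_div (f V (act p a)) (res hV q) =
      gmul (ginv (phi V a)) (torsor_div (f V p) (res hV q)).
  apply: torsor_div_uniq.
  by rewrite fa act_mul gmulA gmulrV gmul1 torsor_divP.
apply: (@torsor_iso_of_map X H Q induce (fun U q => InducedSect (e1 U q) (e2 U q))).
- move=> U V h q; apply: induced_sect_eq => Z hZ p /=.
  by rewrite (res_comp _ _ (subset_trans hZ h)).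
- move=> U q a; apply: induced_sect_eq => Z hZ p /=.
  by apply: torsor_div_uniq; rewrite -act_mul torsor_divP act_res.
Qed.

End Induce.

(* The functions satisfying a local condition [L], with pointwise operations;
   the group axioms are only needed on a set [D] of admissible values. *)
Section FunSheaf.
Variables (X : topologicalType) (A : Type).
Variable L : forall U : opens X, (pts U -> A) -> Prop.
Variables (D : A -> Prop) (mul : A -> A -> A) (one : A) (inv : A -> A).

Record local_group_axioms : Prop := LocalGroupAxioms {
  lg_dom : forall U (f : pts U -> A), L f -> forall x, D (f x);
  lg_res : forall (U V : opens X) (h : V `<=` U) (f : pts U -> A),
    L f -> L (f \o incl h);
  lg_loc : forall (U : opens X) (f : pts U -> A),
    (forall x, U x -> exists2 V : opens X, V x &
      exists h : V `<=` U, L (f \o incl h)) -> L f;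
  lg_one : forall U : opens X, L (fun _ : pts U => one);
  lg_mul : forall U (f g : pts U -> A), L f -> L g ->
    L (fun x => mul (f x) (g x));
  lg_inv : forall U (f : pts U -> A), L f -> L (fun x => inv (f x));
  lg_mulA : forall a b c, D a -> D b -> D c ->
    mul a (mul b c) = mul (mul a b) c;
  lg_mul1 : forall a, D a -> mul one a = a;
  lg_mulV : forall a, D a -> mul (inv a) a = one }.

Variable ax : local_group_axioms.

Definition fsect (U : opens X) : Type := {f : pts U -> A | L f}.

Lemma fsect_eq U (f g : fsect U) : (forall x, sval f x = sval g x) -> f = g.
Proof.
by case: f g => [f Lf] [g Lg] /= /funext e; subst g; congr exist;
  apply: Prop_irrelevance.
Qed.

Lemma pts_eq (U : opens X) (x y : pts U) : sval x = sval y -> x = y.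
Proof.
by case: x y => [x Ux] [y Uy] /= e; subst y; congr exist;
  apply: Prop_irrelevance.
Qed.

Definition fres (U V : opens X) (h : V `<=` U) (f : fsect U) : fsect V :=
  exist _ (sval f \o incl h) (lg_res ax h (svalP f)).

Lemma fglue (U : opens X) (I : Type) (V : I -> opens X)
  (hV : forall i, V i `<=` U) : (forall x, U x -> exists i, V i x) ->
  forall s : forall i, fsect (V i),
  (forall i j (Z : opens X) (hi : Z `<=` V i) (hj : Z `<=` V j),
     fres hi (s i) = fres hj (s j)) ->
  exists! t : fsect U, forall i, fres (hV i) t = s i.
Proof.
move=> cov s comp.
pose k (x : pts U) := cid (cov (sval x) (svalP x)).
pose f (x : pts U) : A := sval (s (sval (k x))) (exist _ (sval x) (svalP (k x))).
have fE i (x : pts (V i)) (y : pts U) : sval x = sval y -> f y = sval (s i) x.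
  move=> xy; rewrite /f; set j := sval (k y); set y' := exist _ _ _.
  pose Z := opens_setI (V j) (V i).
  have h1 : Z `<=` V j by move=> ? [].
  have h2 : Z `<=` V i by move=> ? [].
  have Zy : Z (sval y).
    by split; [exact: (svalP (k y))|rewrite -xy; exact: (svalP x)].
  have := congr1 (fun g : fsect Z => sval g (exist _ (sval y) Zy))
    (comp j i Z h1 h2).
  rewrite /= => e.
  have -> : y' = incl h1 (exist _ (sval y) Zy) by apply: pts_eq.
  by have -> : x = incl h2 (exist _ (sval y) Zy) by apply: pts_eq.
have Lf : L f.
  apply: (lg_loc ax) => x Ux; have [i Vx] := cov x Ux.
  exists (V i) => //; exists (hV i).
  have -> : f \o incl (hV i) = sval (s i) by apply: funext => y; apply: fE.
  exact: (svalP (s i)).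
exists (exist _ f Lf); split.
  by move=> i; apply: fsect_eq => x /=; apply: fE.
move=> t ht; apply: fsect_eq => x /=.
have [i Vx] := cov (sval x) (svalP x).
rewrite (fE i (exist _ (sval x) Vx)) // -(ht i) /=.
by congr (sval t _); apply: pts_eq.
Qed.

Definition fun_sheaf : sheaf X.
Proof.
apply: (@Sheaf X fsect fres); last exact: fglue.
- by move=> U h s; apply: fsect_eq => x /=; congr (sval s _); apply: pts_eq.
- by move=> U V Z hV hZ h s; apply: fsect_eq => x /=;
    congr (sval s _); apply: pts_eq.
Defined.

Definition fun_group_sheaf : group_sheaf X.
Proof.
apply: (@GroupSheaf X fun_sheaf
  (fun U => exist _ _ (lg_one ax U))
  (fun U f g => exist _ _ (lg_mul ax (svalP f) (svalP g)))
  (fun U f => exist _ _ (lg_inv ax (svalP f)))).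
- move=> U a b c; apply: fsect_eq => x /=.
  by apply: (lg_mulA ax); apply: (lg_dom ax); apply: svalP.
- move=> U a; apply: fsect_eq => x /=.
  by apply: (lg_mul1 ax); apply: (lg_dom ax); apply: svalP.
- move=> U a; apply: fsect_eq => x /=.
  by apply: (lg_mulV ax); apply: (lg_dom ax); apply: svalP.
- by move=> U V h a b; apply: fsect_eq.
Defined.

End FunSheaf.

Record matgroup (r : nat) := MatGroup {
  mg_set :> set 'M[int]_r;
  mg_unit : forall w, mg_set w -> w \in unitmx;
  mg_one : mg_set 1%:M;
  mg_mul : forall v w, mg_set v -> mg_set w -> mg_set (v *m w);
  mg_inv : forall w, mg_set w -> mg_set (invmx w) }.

Definition locally_constant (X : topologicalType) (T : Type) (U : opens X)
    (f : pts U -> T) : Prop :=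
  forall x : pts U, exists2 V : opens X, V (sval x) &
    forall y : pts U, V (sval y) -> f y = f x.

Section ConstSheaf.
Variables (X : topologicalType) (r : nat) (W : matgroup r).

Definition const_pred (U : opens X) (f : pts U -> 'M[int]_r) : Prop :=
  (forall x, W (f x)) /\ locally_constant f.

Lemma lc_res T (U V : opens X) (h : V `<=` U) (f : pts U -> T) :
  locally_constant f -> locally_constant (f \o incl h).
Proof.
move=> lc x; have [Z Zx hZ] := lc (incl h x).
by exists Z => // y Zy; apply: hZ.
Qed.

Lemma lc_loc T (U : opens X) (f : pts U -> T) :
  (forall x, U x -> exists2 V : opens X, V x &
    exists h : V `<=` U, locally_constant (f \o incl h)) -> locally_constant f.
Proof.
move=> loc [x Ux]; have [V Vx [h lc]] := loc x Ux.
have [Z Zx hZ] := lc (exist _ x Vx); exists (opens_setI Z V) => // -[y Uy] [Zy Vy].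
have := hZ (exist _ y Vy) Zy; rewrite /= /incl /=.
by rewrite (Prop_irrelevance (h _ _) Uy) (Prop_irrelevance (h _ _) Ux).
Qed.

Lemma lc_map2 (A B C : Type) (op : A -> B -> C) (U : opens X)
  (f : pts U -> A) (g : pts U -> B) : locally_constant f ->
  locally_constant g -> locally_constant (fun x => op (f x) (g x)).
Proof.
move=> lf lg x; have [V Vx hV] := lf x; have [V' V'x hV'] := lg x.
by exists (opens_setI V V') => // y [Vy V'y]; rewrite hV // hV'.
Qed.

Lemma lc_cst (T : Type) (U : opens X) (a : T) :
  locally_constant (fun _ : pts U => a).
Proof. by move=> x; exists U => //; exact: (svalP x). Qed.

Lemma lc_map (A B : Type) (op : A -> B) (U : opens X) (f : pts U -> A) :
  locally_constant f -> locally_constant (fun x => op (f x)).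
Proof.
move=> lf; exact: (lc_map2 (fun a (_ : unit) => op a) lf (lc_cst tt)).
Qed.

Lemma const_axioms :
  local_group_axioms const_pred W (fun v w => v *m w) 1%:M (@invmx _ r).
Proof.
split.
- by move=> U f [].
- by move=> U V h f [hW lc]; split; [move=> x; apply: hW|apply: lc_res].
- move=> U f loc; split.
    move=> [x Ux]; have [V Vx [h [hW _]]] := loc x Ux.
    have := hW (exist _ x Vx); rewrite /= /incl /=.
    by rewrite (Prop_irrelevance (h _ _) Ux).
  by apply: lc_loc => x /loc[V Vx [h [_ lc]]]; exists V => //; exists h.
- by move=> U; split; [move=> _; apply: mg_one|apply: lc_cst].
- move=> U f g [fW lf] [gW lg]; split; first by move=> x; apply: mg_mul.
  exact: (lc_map2 (fun v w => v *m w)).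
- move=> U f [fW lf]; split; first by move=> x; apply: mg_inv.
  exact: lc_map.
- by move=> a b c _ _ _; rewrite mulmxA.
- by move=> a _; rewrite mul1mx.
- by move=> a /mg_unit ua; rewrite mulVmx.
Qed.

Definition const_sheaf : group_sheaf X := fun_group_sheaf const_axioms.

End ConstSheaf.

Section Circle.
Variables (R : realType) (l : R).

Definition circle_eq (x y : R) : bool :=
  `[< exists k : int, y = x + k%:~R * l >].

Lemma circle_eq_equiv : equiv_class_of circle_eq.
Proof.
split.
- by move=> x; apply/asboolP; exists 0; rewrite mul0r addr0.
- move=> x y; apply/idP/idP => /asboolP[k ->]; apply/asboolP; exists (- k);
    by rewrite mulrNz mulNr addrK.
- move=> y x z /asboolP[k ->] /asboolP[j ->]; apply/asboolP; exists (k + j).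
  by rewrite intrD mulrDl addrA.
Qed.

Canonical circle_rel := EquivRelPack circle_eq_equiv.

Definition circle : Type := quotient_topology {eq_quot circle_rel}.
HB.instance Definition _ := Topological.on circle.
HB.instance Definition _ := Quotient.on circle.

Lemma pi_circleP (x y : R) :
  \pi_circle x = \pi_circle y <-> exists k : int, y = x + k%:~R * l.
Proof.
split; first by move=> /eqmodP /asboolP.
by move=> h; apply/eqmodP/asboolP.
Qed.

Lemma pi_circle_near (V : opens circle) (x : R) : V (\pi_circle x) ->
  exists2 e : R, 0 < e & forall t, `|t| < e -> V (\pi_circle (x + t)).
Proof.
move=> Vx; have oV : open (\pi_circle @^-1` V) := opensP V.
have /nbhs_ballP[e /= e0 he] : nbhs x (\pi_circle @^-1` V).
  exact: open_nbhs_nbhs.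
exists e => // t te; apply: he; rewrite /ball /=.
by rewrite opprD addrA subrr sub0r normrN.
Qed.

(* the image in the circle of the open interval of radius [l / 4] around [t] *)
Definition arc_set (t : R) : set circle :=
  [set \pi_circle x | x in [set x | `|x - t| < l / 4]].

Lemma arc_open t : open (arc_set t).
Proof.
rewrite /open /= /quotient_topology.quotient_open /=.
have -> : \pi_circle @^-1` (arc_set t) =
    \bigcup_(k in [set: int]) ball (t + k%:~R * l) (l / 4).
  apply/seteqP; split=> x /=.
    move=> [y yt /pi_circleP[k ->]]; exists k => //; rewrite /ball /=.
    by rewrite opprD addrACA subrr addr0 distrC.
  move=> [k _]; rewrite /ball /= => h; exists (x - k%:~R * l).
    by rewrite /= distrC opprB addrA.
  by apply/pi_circleP; exists k; rewrite subrK.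
by apply: bigcup_open => k _; exact: ball_open.
Qed.

Definition arc (t : R) : opens circle := @Opens circle (arc_set t) (@arc_open t).

(* [f] is continuous and piecewise linear at [\pi x], with outgoing slopes [a]
   and [b]. *)
Definition harmonic_at (U : opens circle) (f : pts U -> R) (x : R) : Prop :=
  exists a b : int, a + b = 0 /\ exists2 e : R, 0 < e &
    forall (t : R) (h0 : U (\pi_circle x)), 0 <= t < e ->
      (forall h : U (\pi_circle (x + t)),
         f (exist _ _ h) = f (exist _ _ h0) + a%:~R * t) /\
      (forall h : U (\pi_circle (x - t)),
         f (exist _ _ h) = f (exist _ _ h0) + b%:~R * t).

Definition harmonic (U : opens circle) (f : pts U -> R) : Prop :=
  forall x : R, U (\pi_circle x) -> harmonic_at f x.

Lemma harmonic_at_loc (U V : opens circle) (f : pts U -> R) (g : pts V -> R)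
  (x : R) : V `<=` U -> V (\pi_circle x) ->
  (forall y (hU : U y) (hV : V y), f (exist _ y hU) = g (exist _ y hV)) ->
  harmonic_at g x -> harmonic_at f x.
Proof.
move=> VU Vx fg [a [b [ab [e e0 he]]]]; exists a, b; split => //.
have [d d0 hd] := pi_circle_near Vx.
exists (Num.min e d); first by rewrite lt_min e0.
move=> t h0 /andP[t0]; rewrite lt_min => /andP[te td].
have td' : `|t| < d by rewrite ger0_norm.
have [|h1 h2] := he t Vx; first by rewrite t0.
split=> h.
  by rewrite (fg _ h (hd _ td')) (fg _ h0 Vx).
have td2 : `|- t| < d by rewrite normrN.
by rewrite (fg _ h (hd _ td2)) (fg _ h0 Vx).
Qed.

Lemma harmonic_at_cst (U : opens circle) (c : R) (x : R) :
  harmonic_at (fun _ : pts U => c) x.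
Proof.
exists 0, 0; split; first by rewrite addr0.
by exists 1 => // t _ _; split => h; rewrite mul0r addr0.
Qed.

Lemma harmonic_at_lin (U : opens circle) (f g : pts U -> R) (c : int) (x : R) :
  harmonic_at f x -> harmonic_at g x ->
  harmonic_at (fun y => f y + c%:~R * g y) x.
Proof.
move=> [a [b [ab [e e0 he]]]] [a' [b' [ab' [e' e0' he']]]].
exists (a + c * a'), (b + c * b'); split.
  by rewrite addrACA ab -mulrDr ab' mulr0 addr0.
exists (Num.min e e'); first by rewrite lt_min e0.
move=> t h0 /andP[t0]; rewrite lt_min => /andP[te te'].
have [|h1 h2] := he t h0; first by rewrite t0.
have [|h1' h2'] := he' t h0; first by rewrite t0.
split=> h; rewrite ?h1 ?h2 ?h1' ?h2' intrD intrM.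
  by rewrite mulrDr mulrDl addrACA mulrA.
by rewrite mulrDr mulrDl addrACA mulrA.
Qed.

Lemma harmonic_at_sum (U : opens circle) n (f : 'I_n -> pts U -> R)
  (c : 'I_n -> int) (x : R) : (forall i, harmonic_at (f i) x) ->
  harmonic_at (fun y => \sum_i (c i)%:~R * f i y) x.
Proof.
move=> hf; elim: (index_enum _) => [|i s IH].
  have -> : (fun y : pts U => \sum_(i <- [::]) (c i)%:~R * f i y) = fun=> 0.
    by apply: funext => y; rewrite big_nil.
  exact: harmonic_at_cst.
have -> : (fun y => \sum_(i <- i :: s) (c i)%:~R * f i y) =
   fun y => \sum_(i <- s) (c i)%:~R * f i y + (c i)%:~R * f i y.
  by apply: funext => y; rewrite big_cons addrC.
exact: harmonic_at_lin.
Qed.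

(* The sheaf of groups [(Mv (x) H) >< W]: here [Mv = 'cV[int]_r], so that
   [Mv (x) R = 'cV[R]_r] and a section of [Mv (x) H] is a column of harmonic
   functions. *)
Section Tropical.
Variables (r : nat) (W : matgroup r).

Definition intmx (w : 'M[int]_r) : 'M[R]_r := map_mx (fun a : int => a%:~R) w.

Definition sd_mul (g h : 'cV[R]_r * 'M[int]_r) : 'cV[R]_r * 'M[int]_r :=
  (g.1 + intmx g.2 *m h.1, g.2 *m h.2).

Definition sd_one : 'cV[R]_r * 'M[int]_r := (0, 1%:M).

Definition sd_inv (g : 'cV[R]_r * 'M[int]_r) : 'cV[R]_r * 'M[int]_r :=
  (- (intmx (invmx g.2) *m g.1), invmx g.2).

Definition trop_pred (U : opens circle)
    (g : pts U -> 'cV[R]_r * 'M[int]_r) : Prop :=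
  (forall i, harmonic (fun x => (g x).1 i 0)) /\
  const_pred W (fun x => (g x).2).

Lemma intmxM (v w : 'M[int]_r) : intmx (v *m w) = intmx v *m intmx w.
Proof.
apply/matrixP => i j; rewrite !mxE rmorph_sum /=.
by apply: eq_bigr => k _; rewrite !mxE intrM.
Qed.

Lemma intmx1 : intmx 1%:M = 1%:M.
Proof. by apply/matrixP => i j; rewrite !mxE; case: eqP. Qed.

Lemma harmonic_lc_lin (U : opens circle) (c : int) (f h : pts U -> 'cV[R]_r)
  (w : pts U -> 'M[int]_r) : locally_constant w ->
  (forall i, harmonic (fun x => f x i 0)) ->
  (forall i, harmonic (fun x => h x i 0)) ->
  forall i, harmonic (fun x => (f x + c%:~R *: (intmx (w x) *m h x)) i 0).
Proof.
move=> lw hf hh i x Ux; have [V0 V0x hV0] := lw (exist _ _ Ux).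
pose V := opens_setI U V0.
have hV : V `<=` U by move=> ? [].
have Vx : V (\pi_circle x) by [].
pose w0 := w (exist _ _ Ux).
apply: (@harmonic_at_loc _ V _ (fun y => f (incl hV y) i 0 + c%:~R *
  (\sum_j (w0 i j)%:~R * h (incl hV y) j 0)) x hV Vx).
  move=> y Uy Vy; rewrite !mxE /incl /=.
  rewrite (Prop_irrelevance (hV _ _) Uy); congr (_ + _ * _).
  by apply: eq_bigr => j _; rewrite !mxE hV0 //; case: Vy.
have resh (k : pts U -> R) : harmonic_at k x ->
    harmonic_at (fun y : pts V => k (incl hV y)) x.
  move=> [a [b [ab [e e0 he]]]]; exists a, b; split => //; exists e => //.
  move=> t h0 te; have [h1 h2] := he t (hV _ h0) te.
  by split=> h1'; [exact: (h1 (hV _ h1'))|exact: (h2 (hV _ h1'))].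
apply: harmonic_at_lin; first exact/(resh (fun y => f y i 0))/hf.
apply: (@harmonic_at_sum V r (fun j y => h (incl hV y) j 0)) => j.
exact/(resh (fun y => h y j 0))/hh.
Qed.

Lemma trop_pred_const (U : opens circle) g : @trop_pred U g ->
  const_pred W (fun x => (g x).2).
Proof. by case. Qed.

Lemma trop_axioms :
  local_group_axioms trop_pred (fun g => W g.2) sd_mul sd_one sd_inv.
Proof.
have cax := @const_axioms circle r W.
split.
- by move=> U f [_ []].
- move=> U V h f [hf wf]; split; last exact: (lg_res cax h wf).
  move=> i x Vx; have [a [b [ab [e e0 he]]]] := hf i x (h _ Vx).
  exists a, b; split => //; exists e => // t h0 te.
  have [h1 h2] := he t (h _ h0) te.
  by split=> h1'; [exact: (h1 (h _ h1'))|exact: (h2 (h _ h1'))].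
- move=> U f loc; split.
    move=> i x Ux; have [V Vx [h [hf _]]] := loc _ Ux.
    apply: (harmonic_at_loc h Vx _ (hf i x Vx)) => y hU hV /=.
    by rewrite /incl /= (Prop_irrelevance (h _ _) hU).
  by apply: (lg_loc cax) => x /loc[V Vx [h [_ wf]]]; exists V => //; exists h.
- move=> U; split; last exact: (lg_one cax).
  by move=> i x _; apply: harmonic_at_cst.
- move=> U f g [hf wf] [hg wg]; split; last exact: (lg_mul cax wf wg).
  move=> i; have := harmonic_lc_lin 1 wf.2 hf hg i.
  by under [X in harmonic X -> _]eq_fun do rewrite scale1r.
- move=> U f [hf wf]; split; last exact: (lg_inv cax wf).
  have h0 i : harmonic (fun _ : pts U => (0 : 'cV[R]_r) i 0).
    by move=> x _; apply: harmonic_at_cst.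
  move=> i; have := harmonic_lc_lin (- 1) (lg_inv cax wf).2 h0 hf i.
  by under [X in harmonic X -> _]eq_fun do rewrite add0r mulrN1z scaleN1r.
- move=> a b c _ _ _; rewrite /sd_mul /= mulmxDr addrA mulmxA -intmxM.
  by rewrite mulmxA.
- by move=> [m w] _; rewrite /sd_mul /= intmx1 !mul1mx add0r.
- move=> [m w] /mg_unit /= uw; rewrite /sd_mul /sd_inv /= addNr.
  by rewrite mulVmx.
Qed.

Definition trop_sheaf : group_sheaf circle := fun_group_sheaf trop_axioms.

Definition trop_proj : gsheaf_hom trop_sheaf (const_sheaf circle W).
Proof.
exists (fun U g => exist (@const_pred _ _ W U) (fun x => (sval g x).2)
  (trop_pred_const (svalP g))).
- by move=> U a b; apply: fsect_eq.
- by move=> U V h a; apply: fsect_eq.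
Defined.

End Tropical.

End Circle.

Section TropicalHom.
Variables (R : realType) (l : R) (r : nat).
Implicit Types W : matgroup r.

Definition const_incl W W' (h : W `<=` W') (X : topologicalType) :
  gsheaf_hom (const_sheaf X W) (const_sheaf X W').
Proof.
exists (fun U g => exist (@const_pred X r W' U) (sval g)
  (conj (fun x => h _ (proj1 (svalP g) x)) (proj2 (svalP g)))).
- by move=> U a b; apply: fsect_eq.
- by move=> U V k a; apply: fsect_eq.
Defined.

Lemma trop_pred_incl W W' (h : W `<=` W') (U : opens (circle l)) g :
  @trop_pred R l r W U g -> @trop_pred R l r W' U g.
Proof. by case=> hg [gW lg]; split => //; split => // x; apply: h. Qed.

Definition trop_incl W W' (h : W `<=` W') :
  gsheaf_hom (trop_sheaf l W) (trop_sheaf l W').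
Proof.
exists (fun U g => exist (@trop_pred R l r W' U) (sval g)
  (trop_pred_incl h (svalP g))).
- by move=> U a b; apply: fsect_eq.
- by move=> U V k a; apply: fsect_eq.
Defined.

Definition normalizer (W' W : matgroup r) : set 'M[int]_r :=
  [set n | W' n /\ forall w, W (n *m w *m invmx n) <-> W w].

(* conjugation by [(0, n)] *)
Definition sd_conj (n : 'M[int]_r) (g : 'cV[R]_r * 'M[int]_r) :
    'cV[R]_r * 'M[int]_r :=
  (intmx R n *m g.1, n *m g.2 *m invmx n).

Lemma trop_pred_conj W' W n : normalizer W' W n ->
  forall (U : opens (circle l)) g, @trop_pred R l r W U g ->
    @trop_pred R l r W U (fun x => sd_conj n (g x)).
Proof.
move=> [W'n nW] U g [hg [gW lg]]; split; last first.
  by split; [move=> x; apply/nW|exact: (lc_map (fun w => n *m w *m invmx n) lg)].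
have h0 i : harmonic (fun _ : pts U => (0 : 'cV[R]_r) i 0).
  by move=> x _; apply: harmonic_at_cst.
move=> i; have := harmonic_lc_lin 1 (lc_cst n) h0 hg i.
by under [X in harmonic X -> _]eq_fun do rewrite add0r scale1r.
Qed.

Definition trop_conj W' W n (hn : normalizer W' W n) :
  gsheaf_hom (trop_sheaf l W) (trop_sheaf l W).
Proof.
exists (fun U g => exist (@trop_pred R l r W U) (fun x => sd_conj n (sval g x))
  (trop_pred_conj hn (svalP g))).
- have un : n \in unitmx by case: hn => /mg_unit.
  move=> U a b; apply: fsect_eq => x /=; rewrite /sd_conj /sd_mul /=.
  congr (_, _).
    rewrite mulmxDr !mulmxA -!intmxM; congr (_ + _ *m _); congr (intmx R _).
    by rewrite -!mulmxA mulVmx // mulmx1.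
  by rewrite !mulmxA; congr (_ *m _ *m _); rewrite -!mulmxA mulVmx // mulmx1.
- by move=> U V k a; apply: fsect_eq.
Defined.

End TropicalHom.

(* The lattices are [M = 'rV[int]_rk] and [Mv = 'cV[int]_rk], in dual bases;
   only the values of [coroot] on [roots] matter. Root data need not be
   reduced. *)

Definition pairing (r : nat) (x : 'rV[int]_r) (y : 'cV[int]_r) : int :=
  (x *m y) 0 0.

Record root_datum := RootDatum {
  rk : nat;
  roots : seq 'rV[int]_rk;
  coroot : 'rV[int]_rk -> 'cV[int]_rk;
  coroot_inj : {in roots &, injective coroot};
  pairing_coroot : forall a, a \in roots -> pairing a (coroot a) = 2;
  refl_roots : forall a b, a \in roots -> b \in roots ->
    b - pairing b (coroot a) *: a \in roots;
  refl_coroots : forall a b, a \in roots -> b \in roots ->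
    coroot b - pairing a (coroot b) *: coroot a \in map coroot roots }.

Inductive mx_generated (r : nat) (S : set 'M[int]_r) : 'M[int]_r -> Prop :=
  | Gen_one : mx_generated S 1%:M
  | Gen_mul s w : S s -> mx_generated S w -> mx_generated S (s *m w)
  | Gen_inv s w : S s -> mx_generated S w -> mx_generated S (invmx s *m w).

Section Generated.
Variables (r : nat) (S : set 'M[int]_r).
Hypothesis S_unit : forall s, S s -> s \in unitmx.

Lemma generated_unit w : mx_generated S w -> w \in unitmx.
Proof.
elim=> [|s v /S_unit us _ uv|s v /S_unit us _ uv]; first exact: unitmx1.
  by rewrite unitmx_mul us.
by rewrite unitmx_mul unitmx_inv us.
Qed.

Lemma generated_mul v w :
  mx_generated S v -> mx_generated S w -> mx_generated S (v *m w).
Proof.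
move=> gv gw; elim: gv => [|s u Ss _ gu'|s u Ss _ gu'].
- by rewrite mul1mx.
- by rewrite -mulmxA; apply: Gen_mul.
- by rewrite -mulmxA; apply: Gen_inv.
Qed.

Lemma generated_inv w : mx_generated S w -> mx_generated S (invmx w).
Proof.
have invM (u v : 'M[int]_r) : u \in unitmx -> v \in unitmx ->
    invmx (u *m v) = invmx v *m invmx u.
  move=> uu uv; have uuv : u *m v \in unitmx by rewrite unitmx_mul uu.
  apply: (can_inj (mulKmx uuv)).
  by rewrite mulmxV // mulmxA (mulmxK uv) mulmxV.
elim=> [|s v Ss gv gv'|s v Ss gv gv'].
- by rewrite invmx1; apply: Gen_one.
- rewrite (invM _ _ (S_unit Ss) (generated_unit gv)).
  apply: (generated_mul gv').
  by rewrite -[invmx s]mulmx1; apply: Gen_inv => //; apply: Gen_one.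
- have us' : invmx s \in unitmx by rewrite unitmx_inv S_unit.
  rewrite (invM _ _ us' (generated_unit gv)) invmxK.
  apply: (generated_mul gv').
  by rewrite -[s]mulmx1; apply: Gen_mul => //; apply: Gen_one.
Qed.

Definition generated_matgroup : matgroup r :=
  MatGroup generated_unit (Gen_one S) generated_mul generated_inv.

End Generated.

Section Weyl.
Variable Phi : root_datum.
Local Notation r := (rk Phi).

(* the reflection [y |-> y - <a, y> coroot a] of [Mv] *)
Definition refl (a : 'rV[int]_r) : 'M[int]_r := 1%:M - coroot a *m a.

Lemma refl_invol a : a \in roots Phi -> refl a *m refl a = 1%:M.
Proof.
move=> ha; rewrite /refl mulmxBr mulmx1 mulmxBl mul1mx.
have -> : coroot a *m a *m (coroot a *m a) = (coroot a *m a) *+ 2.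
  rewrite mulmxA -(mulmxA (coroot a)) [a *m coroot a]mx11_scalar.
  have := pairing_coroot ha; rewrite /pairing => ->.
  by rewrite mul_mx_scalar -scalemxAl scaler_nat.
by rewrite mulr2n opprB addrK subrK.
Qed.

Lemma refl_unit a : a \in roots Phi -> refl a \in unitmx.
Proof. by move=> /refl_invol /mulmx1_unit[]. Qed.

Definition refls (J : seq 'rV[int]_r) : set 'M[int]_r :=
  [set refl a | a in [set a | a \in J]].

Lemma refls_unit s : refls (roots Phi) s -> s \in unitmx.
Proof. by move=> [a ha <-]; apply: refl_unit. Qed.

Definition weyl : matgroup r :=
  generated_matgroup (S := refls (roots Phi)) refls_unit.

Definition root_base (B : seq 'rV[int]_r) : Prop :=
  [/\ uniq B, {subset B <= roots Phi},
      forall c : 'rV[int]_r -> int, \sum_(a <- B) c a *: a = 0 ->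
        forall a, a \in B -> c a = 0
    & forall b, b \in roots Phi -> exists2 c : 'rV[int]_r -> int,
        b = \sum_(a <- B) c a *: a &
        (forall a, a \in B -> 0 <= c a) \/ (forall a, a \in B -> c a <= 0)].

(* [W] is a parabolic subgroup, with [S] as its set of simple reflections. *)
Definition parabolic (W : matgroup r) (S : set 'M[int]_r) : Prop :=
  exists B J : seq 'rV[int]_r, exists u : 'M[int]_r,
    [/\ root_base B, {subset J <= B}, weyl u,
        mg_set W = [set u *m w *m invmx u | w in mx_generated (refls J)]
      & S = [set u *m s *m invmx u | s in refls J]].

End Weyl.

Lemma parabolic_sub (Phi : root_datum) (W : matgroup (rk Phi)) S :
  parabolic W S -> W `<=` weyl Phi.
Proof.
move=> [B [J [u [[_ BR _ _] JB Wu WE _]]]]; rewrite WE => _ [w gw <-].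
apply: mg_mul; last exact: mg_inv.
apply: mg_mul => //.
have JR s : refls J s -> refls (roots Phi) s.
  by move=> [a /= aJ <-]; exists a => //; apply/BR/JB.
by elim: gw => [|s v /JR Ss _|s v /JR Ss _];
  [exact: Gen_one|exact: Gen_mul|exact: Gen_inv].
Qed.

Section TypeA.
Variables (k : nat) (n : 'I_k -> nat).

Definition sym_prod : finGroupType := {dffun forall i : 'I_k, 'S_(n i)}.

Definition simple_transpositions : set sym_prod :=
  [set s | exists (i : 'I_k) (j j' : 'I_(n i)),
     j' = j.+1 :> nat /\ s = dfung1 (tperm j j')].

Definition full_cycles (c : sym_prod) : Prop :=
  forall i (x y : 'I_(n i)), y \in porbit (c i) x.

(* [phi] is an isomorphism of Coxeter groups onto [(W, S)]. *)
Definition coxeter_iso r (W : matgroup r) (S : set 'M[int]_r)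
    (phi : sym_prod -> 'M[int]_r) : Prop :=
  [/\ {morph phi : s t / (s * t)%g >-> s *m t}, injective phi,
      range phi = W & phi @` simple_transpositions = S].

End TypeA.

(* The [sigma t], sections over the arcs around [t], form a section of the
   pullback of [tau] to the universal cover [R], whose value at [t + l] is the
   translate by [w] of its value at [t]. *)
Definition has_monodromy (R : realType) (l : R) r (W : matgroup r)
    (tau : torsor (const_sheaf (circle l) W)) (w : 'M[int]_r) : Prop :=
  exists sigma : forall t : R, tau (arc l t),
    (forall (t t' : R) (V : opens (circle l)) (h : V `<=` arc l t)
       (h' : V `<=` arc l t'), `|t - t'| < l / 2 ->
       res h (sigma t) = res h' (sigma t')) /\
    (forall (t : R) (V : opens (circle l)) (h : V `<=` arc l t)
       (h' : V `<=` arc l (t + l)), exists2 g : const_sheaf (circle l) W V,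
       (forall x, sval g x = w) &
       res h' (sigma (t + l)) = act (res h (sigma t)) g).

(* Torsors live in a universe too large for [set] and [set_bij]; these are the
   same notions, without that bound. *)
Definition family (T : Type) : Type := T -> Prop.

Definition family_image (T T' : Type) (f : T -> T') (A : family T) : family T' :=
  fun y => exists2 x, A x & f x = y.

Definition family_bij (T T' : Type) (A : family T) (B : family T')
    (f : T -> T') : Prop :=
  [/\ forall x, A x -> B (f x),
      forall x y, A x -> A y -> f x = f y -> x = y
    & forall y, B y -> exists2 x, A x & f x = y].

Section Moduli.
Variables (R : realType) (l : R) (r : nat).

Definition bundle (W : matgroup r) := torsor (trop_sheaf l W).

Definition iso_class (W : matgroup r) (P : bundle W) : family (bundle W) :=
  fun Q => torsor_iso P Q.

Definition moduli (W : matgroup r) (tau : torsor (const_sheaf (circle l) W)) :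
    family (family (bundle W)) :=
  family_image (@iso_class W)
    (fun P : bundle W => torsor_iso (induce (trop_proj l W) P) tau).

Variables (W' W : matgroup r).

Definition normalizer_quotient : set (set 'M[int]_r) :=
  [set [set n *m w | w in mg_set W] | n in normalizer W' W].

(* the action of a coset of [W] in its normalizer on an isomorphism class *)
Definition coset_act (C : set 'M[int]_r) (c : family (bundle W)) :
    family (bundle W) :=
  fun Q => exists n (hn : normalizer W' W n), C n /\
    exists2 P, c P & torsor_iso (induce (trop_conj l hn) P) Q.

Definition coset_orbit (c : family (bundle W)) : family (family (bundle W)) :=
  family_image (fun C => coset_act C c) normalizer_quotient.

Definition moduli_quotient (tau : torsor (const_sheaf (circle l) W)) :
    family (family (family (bundle W))) :=
  family_image coset_orbit (moduli tau).

(* The value at an orbit consists of all [G']-bundles isomorphic to one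
   induced from a bundle in the orbit; that this is a single isomorphism class
   is part of the assertion that the map takes values in some [moduli]. *)
Definition natural_map (h : W `<=` W') (o : family (family (bundle W))) :
    family (bundle W') :=
  fun Q => exists2 c, o c &
    exists2 P, c P & torsor_iso (induce (trop_incl l h) P) Q.

End Moduli.

(* Main.v *)
From Pilot Require Import Defs.
From HB Require Import structures.
From mathcomp Require Import all_boot all_order all_algebra all_fingroup.
From mathcomp Require Import all_classical all_reals all_analysis.
From mathcomp Require Import zify ring lra.
Set Implicit Arguments.
Unset Strict Implicit.
Import Order.TTheory GRing.Theory Num.Theory.
Local Open Scope ring_scope.
Import numFieldNormedType.Exports.
Import Pilot.Defs.

(* In terms of torsors, surjectivity is the reduction of the structure group: a
   [G']-bundle [Q] whose [W']-torsor is induced from [ind] is induced from the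
   fibre product of [Q] and [ind] over that [W']-torsor. For injectivity, an
   isomorphism between the [G']-bundles induced from [P1] and [P2] yields an
   automorphism of the [W']-torsor induced from [ind]; the circle being
   connected, this is an element [x] of [W'] commuting with the monodromy [w].
   If [x] normalizes [W], then [P2] is the conjugate of [P1] by [x].

   That the centralizer of [w] normalizes [W] is seen on [M]. A conjugate of
   [w] is the product of all simple reflections of [W], in some order; since
   the simple roots are independent, the row vectors fixed by [w] are those
   fixed by [W]. Thus [x] preserves the fixed space of [W], and a parabolic
   subgroup is the stabilizer of a generic vector in its fixed space. *)

(** * Root data *)

Section Roots.
Variable Phi : root_datum.
Local Notation r := (rk Phi).
Local Notation RR := (roots Phi).
Implicit Types (a b : 'rV[int]_r) (y : 'cV[int]_r) (g : 'M[int]_r).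

Lemma pairingDl a b y : pairing (a + b) y = pairing a y + pairing b y.
Proof. by rewrite /pairing mulmxDl mxE. Qed.

Lemma pairingZl (c : int) b y : pairing (c *: b) y = c * pairing b y.
Proof. by rewrite /pairing -scalemxAl mxE. Qed.

Lemma pairingNl b y : pairing (- b) y = - pairing b y.
Proof. by rewrite /pairing mulNmx mxE. Qed.

Lemma pairing0l y : pairing 0 y = 0.
Proof. by rewrite /pairing mul0mx mxE. Qed.

Lemma pairing_suml (I : Type) (s : seq I) (F : I -> 'rV[int]_r) y :
  pairing (\sum_(i <- s) F i) y = \sum_(i <- s) pairing (F i) y.
Proof. by rewrite /pairing mulmx_suml summxE. Qed.

Lemma pairing_mulmx b g y : pairing (b *m g) y = pairing b (g *m y).
Proof. by rewrite /pairing mulmxA. Qed.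

Lemma mulmx_pairing y b z : y *m b *m z = pairing b z *: y.
Proof. by rewrite -mulmxA [b *m z]mx11_scalar mul_mx_scalar. Qed.

Lemma row_refl b a : b *m refl a = b - pairing b (coroot a) *: a.
Proof.
by rewrite /refl mulmxBr mulmx1 mulmxA [b *m _]mx11_scalar mul_scalar_mx.
Qed.

Lemma refl_col a y : refl a *m y = y - pairing a y *: coroot a.
Proof. by rewrite /refl mulmxBl mul1mx mulmx_pairing. Qed.

Lemma root_refl_opp a : a \in RR -> a *m refl a = - a.
Proof.
move=> ha; rewrite row_refl pairing_coroot // scaler_nat mulr2n opprD addrA.
by rewrite subrr sub0r.
Qed.

Lemma refl_invmx a : a \in RR -> invmx (refl a) = refl a.
Proof.
move=> ha; have ua := refl_unit ha.
by apply: (can_inj (mulKmx ua)); rewrite mulmxV // refl_invol.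
Qed.

Lemma weyl_refl a : a \in RR -> weyl Phi (refl a).
Proof.
move=> ha; rewrite -[refl a]mulmx1; apply: Gen_mul; last exact: Gen_one.
by exists a.
Qed.

Lemma weyl_root g b : weyl Phi g -> b \in RR -> b *m g \in RR.
Proof.
move=> wg; elim: wg b => [|s w [a /= ha <-] _ IH|s w [a /= ha <-] _ IH] b hb.
- by rewrite mulmx1.
- by rewrite mulmxA; apply: IH; rewrite row_refl refl_roots.
- by rewrite mulmxA refl_invmx //; apply: IH; rewrite row_refl refl_roots.
Qed.

Lemma weyl_coroot g y : weyl Phi g -> y \in map (@coroot Phi) RR ->
  g *m y \in map (@coroot Phi) RR.
Proof.
move=> wg; elim: wg y => [|s w [a /= ha <-] _ IH|s w [a /= ha <-] _ IH] y hy.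
- by rewrite mul1mx.
- rewrite -mulmxA; have /mapP[b hb ->] := IH _ hy.
  by rewrite refl_col refl_coroots.
- rewrite -mulmxA refl_invmx //; have /mapP[b hb ->] := IH _ hy.
  by rewrite refl_col refl_coroots.
Qed.

(* Otherwise the products of [1 - y b] and [refl b] are transvections of
   infinite order preserving the finite set of coroots. *)
Lemma coroot_uniq b y : b \in RR -> pairing b y = 2 ->
  (forall z, z \in map (@coroot Phi) RR ->
     (1%:M - y *m b) *m z \in map (@coroot Phi) RR) -> y = coroot b.
Proof.
move=> hb by2 py; set v := coroot b.
have bv : pairing b v = 2 by apply: pairing_coroot.
(* The image of [v] under the [m]-th power of [(1 - y b) refl b]. As [b] takes the value 2 on both
   [v] and [y], each application adds [2 (y - v)]. *)
pose t (m : nat) : 'cV[int]_r := v + (m.*2)%:R *: (y - v).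
have ht m : t m \in map (@coroot Phi) RR.
  elim: m => [|m IH]; first by rewrite /t scale0r addr0; apply: map_f.
  have -> : t m.+1 = (1%:M - y *m b) *m (refl b *m t m).
    have bt : pairing b (t m) = 2.
      have -> : pairing b (t m) =
          pairing b v + (m.*2)%:R * (pairing b y - pairing b v).
        by rewrite /t /pairing mulmxDr mxE -scalemxAr mxE mulmxBr !mxE.
      by rewrite by2 bv subrr mulr0 addr0.
    rewrite refl_col bt mulmxBl mul1mx mulmx_pairing.
    have -> : pairing b (t m - 2 *: coroot b) = - 2.
      have -> : pairing b (t m - 2 *: coroot b) =
          pairing b (t m) - 2 * pairing b v.
        by rewrite /pairing mulmxBr -scalemxAr !mxE.
      by rewrite bt bv.
    rewrite /t doubleS -[m.*2.+2]addn2 natrD -/v.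
    by apply/matrixP => i j; rewrite !mxE; ring.
  by apply: py; rewrite refl_col; case/mapP: IH => c hc ->;
    apply: refl_coroots.
apply/eqP/negPn/negP => yv.
have tI : injective t.
  move=> m m' /addrI /eqP; rewrite -subr_eq0 -scalerBl scalemx_eq0 => /orP[|].
    by rewrite subr_eq0 eqr_nat -!muln2 eqn_pmul2r // => /eqP.
  by rewrite subr_eq0 (negPf yv).
(* Pigeonhole: one more distinct vector than the list of coroots has entries. *)
have := @uniq_leq_size _ [seq t m | m <- iota 0 (size RR).+1]
  (map (@coroot Phi) RR).
rewrite map_inj_uniq // iota_uniq !size_map size_iota ltnn.
by move=> absurd; have : false by apply: absurd => // _ /mapP[m _ ->].
Qed.

Lemma weyl_invl g : weyl Phi g -> invmx g *m g = 1%:M.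
Proof. by move=> /mg_unit ug; rewrite mulVmx. Qed.

Lemma weyl_invr g : weyl Phi g -> g *m invmx g = 1%:M.
Proof. by move=> /mg_unit ug; rewrite mulmxV. Qed.

(** The conjugate is [1 - (g^-1 coroot a) (a g)] and preserves the coroots, so [coroot_uniq]
    identifies [g^-1 coroot a] with the coroot of [a g]. *)
Lemma refl_conj g a : weyl Phi g -> a \in RR ->
  refl (a *m g) = invmx g *m refl a *m g.
Proof.
move=> wg ha; have wV := mg_inv wg.
have e : 1%:M - (invmx g *m coroot a) *m (a *m g) = invmx g *m refl a *m g.
  rewrite /refl mulmxBr mulmxBl mulmx1 weyl_invl //.
  by rewrite !mulmxA.
rewrite -e {1}/refl; congr (_ - _ *m _); apply/esym/coroot_uniq.
- exact: weyl_root.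
- rewrite pairing_mulmx mulmxA weyl_invr // mul1mx.
  exact: pairing_coroot.
- move=> z hz; rewrite e; apply: weyl_coroot hz.
  by apply: mg_mul => //; apply: mg_mul => //; apply: weyl_refl.
Qed.

(** The vector [c coroot (c a)] pairs to 2 with [a] and yields the reflection of [c a], so
    [coroot_uniq] identifies it with [coroot a]. This handles opposite roots, and double roots when
    the datum is not reduced. *)
Lemma refl_multiple (c : int) a : a \in RR -> c *: a \in RR ->
  refl (c *: a) = refl a.
Proof.
move=> ha hca.
have e : 1%:M - (c *: coroot (c *: a)) *m a = refl (c *: a).
  by rewrite /refl -scalemxAl -scalemxAr.
rewrite -e; congr (_ - _ *m _); apply: coroot_uniq => //.
  rewrite -(pairing_coroot hca) /pairing -scalemxAr -scalemxAl.
  by rewrite !mxE.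
by move=> z hz; rewrite e; apply: weyl_coroot hz; apply: weyl_refl.
Qed.

Local Notation UR := (undup RR).

(** Right multiplication by [g] permutes the roots. Removing duplicates makes this a permutation of
    a list without repetitions. *)
Lemma big_weyl (V : zmodType) (F : 'rV[int]_r -> V) g : weyl Phi g ->
  \sum_(b <- UR) F (b *m g) = \sum_(b <- UR) F b.
Proof.
move=> wg; have gK : cancel (mulmx^~ g) (mulmx^~ (invmx g)).
  by move=> n b /=; rewrite -mulmxA weyl_invr // mulmx1.
rewrite -(big_map (fun b => b *m g) xpredT F); apply: perm_big.
have hs : {subset [seq b *m g | b <- UR] <= UR}.
  move=> _ /mapP[b + ->]; rewrite !mem_undup; exact: weyl_root.
have u1 : uniq [seq b *m g | b <- UR].
  by rewrite map_inj_uniq ?undup_uniq //; apply: can_inj (gK _).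
have [_ eqm] := uniq_min_size u1 hs (eq_leq (esym (size_map _ _))).
exact: (uniq_perm u1 (undup_uniq _)).
Qed.

(* the map from [Mv] to [M] given by the canonical invariant form *)
Definition root_form y : 'rV[int]_r := \sum_(b <- UR) pairing b y *: b.

Lemma root_form_mul g y : weyl Phi g ->
  root_form y *m invmx g = root_form (g *m y).
Proof.
move=> wg; rewrite /root_form -[RHS](big_weyl _ (mg_inv wg)) mulmx_suml.
apply: eq_bigr => b _; rewrite -scalemxAl -!pairing_mulmx -mulmxA.
by rewrite weyl_invl // mulmx1.
Qed.

(** The squared length of [coroot a] for the form behind [root_form]. *)
Definition coroot_norm a : int := \sum_(b <- UR) pairing b (coroot a) ^+ 2.

Lemma coroot_norm_gt0 a : a \in RR -> 0 < coroot_norm a.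
Proof.
move=> ha; rewrite /coroot_norm (bigD1_seq a) ?undup_uniq ?mem_undup //=.
rewrite pairing_coroot // ltr_pwDl //.
by apply: sumr_ge0 => b _; apply: sqr_ge0.
Qed.

(** Substituting [b *m refl a] for [b] preserves the sum of [<b, y> <b, coroot a>]. It negates the
    second factor and lowers the first by [<a, y> <b, coroot a>], so the sum equals its opposite
    plus the right-hand side. *)
Lemma root_form_coroot a y : a \in RR ->
  2 * pairing (root_form y) (coroot a) = pairing a y * coroot_norm a.
Proof.
move=> ha; rewrite /root_form pairing_suml.
set S := \sum_(i <- _) _.
have e : S = - S + pairing a y * coroot_norm a.
  rewrite {1}/S -(big_weyl _ (weyl_refl ha)) /coroot_norm mulr_sumr -sumrN.
  rewrite -big_split /=; apply: eq_bigr => b _.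
  rewrite !pairingZl !pairing_mulmx !refl_col pairing_coroot //.
  have E z w (d : int) : pairing b (z - d *: w) = pairing b z - d * pairing b w.
    by rewrite /pairing mulmxBr -scalemxAr !mxE.
  by rewrite !E; ring.
by rewrite mulr_natl mulr2n {1}e addrAC addNr add0r.
Qed.

(** Both sides are twice the symmetric sum of [<x, coroot a> <x, coroot b>] over the roots [x]. As
    the norms are positive, signs pass between the two pairings. *)
Lemma pairing_coroot_sym a b : a \in RR -> b \in RR ->
  pairing b (coroot a) * coroot_norm b = pairing a (coroot b) * coroot_norm a.
Proof.
move=> ha hb; rewrite -!root_form_coroot //; congr (2 * _).
rewrite /root_form !pairing_suml; apply: eq_bigr => c _.
by rewrite !pairingZl mulrC.
Qed.

Lemma pairing_coroot_gt0 a b : a \in RR -> b \in RR ->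
  (0 < pairing b (coroot a)) = (0 < pairing a (coroot b)).
Proof.
move=> ha hb; rewrite -(pmulr_lgt0 _ (coroot_norm_gt0 hb)).
by rewrite (pairing_coroot_sym ha hb) (pmulr_lgt0 _ (coroot_norm_gt0 ha)).
Qed.

End Roots.

(** * Simple roots and parabolic subgroups *)

Lemma rat_mx_denom (m n : nat) (A : 'M[rat]_(m, n)) :
  exists2 d : int, 0 < d & exists C : 'M[int]_(m, n),
    d%:~R *: A = map_mx intr C.
Proof.
exists (\prod_i \prod_j denq (A i j)).
  by apply: prodr_gt0 => i _; apply: prodr_gt0 => j _; apply: denq_gt0.
pose C i j := numq (A i j) * (\prod_(i' | i' != i) \prod_j' denq (A i' j') *
  \prod_(j' | j' != j) denq (A i j')).
exists (\matrix_(i, j) C i j); apply/matrixP => i j; rewrite !mxE /C.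
rewrite (bigD1 i) //= (bigD1 j) //= !intrM numqE.
by ring.
Qed.

(** Clearing denominators turns independence over the integers into independence over the rationals,
    so the matrix with rows [B] has a rational right inverse. Applied to the values of [f], it gives
    a rational solution, whose common denominator is [d]. *)
Lemma dual_vector (r : nat) (B : seq 'rV[int]_r) : uniq B ->
  (forall c : 'rV[int]_r -> int, \sum_(a <- B) c a *: a = 0 ->
     forall a, a \in B -> c a = 0) ->
  forall f : 'rV[int]_r -> int, exists2 d : int, 0 < d &
    exists y : 'cV[int]_r, forall a, a \in B -> pairing a y = d * f a.
Proof.
move=> uB iB f; pose A0 := \matrix_(i < size B) nth 0 B i.
pose A : 'M[rat]_(size B, r) := map_mx intr A0.
have intr_mx_inj m n (C D : 'M[int]_(m, n)) :
    map_mx intr C = map_mx intr D :> 'M[rat]_(m, n) -> C = D.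
  move=> /matrixP e; apply/matrixP => i j; have := e i j; rewrite !mxE.
  exact: intr_inj.
have fA : row_free A.
  apply: inj_row_free => u uA; have [d d0 [v dv]] := rat_mx_denom u.
  suff v0 : v = 0.
    move: dv; rewrite v0 map_mx0 => /eqP; rewrite scaler_eq0 intr_eq0.
    by rewrite (gt_eqF d0) /= => /eqP.
  have vA : v *m A0 = 0.
    by apply: intr_mx_inj; rewrite map_mxM -dv -scalemxAl uA scaler0 map_mx0.
  (* Coefficients indexed by position become a function of the vector; off [B] the index is out of
     range and the default 0 is taken. *)
  pose c a := if insub (index a B) is Some i then v 0 i else 0.
  have cE (i : 'I_(size B)) : c (nth 0 B i) = v 0 i.
    by rewrite /c index_uniq // valK.
  have h : \sum_(a <- B) c a *: a = 0.
    rewrite (big_nth 0) big_mkord -[RHS]vA mulmx_sum_row.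
    by apply: eq_bigr => i _; rewrite cE rowK.
  apply/rowP => i; rewrite -cE mxE; apply: iB h _ _.
  exact: mem_nth.
pose F : 'cV[rat]_(size B) := \col_i (f (nth 0 B i))%:~R.
have [d d0 [y dy]] := rat_mx_denom (pinvmx A *m F).
exists d => //; exists y => a aB.
have AF : A *m map_mx intr y = d%:~R *: F.
  by rewrite -dy -scalemxAr mulmxA mulmxVp // mul1mx.
have ia : (index a B < size B)%N by rewrite index_mem.
have /matrixP /(_ (Ordinal ia) 0) := AF.
rewrite -map_mxM !mxE /= nth_index // -intrM => /intr_inj <-.
by rewrite /pairing mxE; apply: eq_bigr => j _; rewrite !mxE nth_index.
Qed.

Section Base.
Variables (Phi : root_datum) (B : seq 'rV[int]_(rk Phi)).
Hypothesis hB : root_base B.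
Local Notation r := (rk Phi).
Local Notation RR := (roots Phi).
Implicit Types (a b : 'rV[int]_r) (y : 'cV[int]_r) (g : 'M[int]_r).

Let uB : uniq B. Proof. by case: hB. Qed.
Let BR a : a \in B -> a \in RR. Proof. by case: hB => _ + _ _; apply. Qed.

Definition refl_word (t : seq 'rV[int]_r) : 'M[int]_r :=
  foldr (fun a g => refl a *m g) 1%:M t.

Lemma refl_word_cat t t' : refl_word (t ++ t') = refl_word t *m refl_word t'.
Proof. by elim: t => /= [|a t ->]; rewrite ?mul1mx ?mulmxA. Qed.

Lemma coords_inj (c c' : 'rV[int]_r -> int) :
  \sum_(a <- B) c a *: a = \sum_(a <- B) c' a *: a ->
  forall a, a \in B -> c a = c' a.
Proof.
move=> e a aB; apply/eqP; rewrite -subr_eq0; apply/eqP.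
case: hB => _ _ iB _; apply: (iB (fun a => c a - c' a)) => //.
under eq_bigr do rewrite scalerBl.
by rewrite sumrB e subrr.
Qed.

Definition pos_root b : Prop := exists2 c : 'rV[int]_r -> int,
  b = \sum_(a <- B) c a *: a & forall a, a \in B -> 0 <= c a.

Lemma pos_root_opp b : b \in RR -> ~ pos_root b -> pos_root (- b).
Proof.
move=> hb nb; case: hB => _ _ _ /(_ _ hb)[c bc [c0|c0]].
  by case: nb; exists c.
exists (fun a => - c a) => [|a aB]; last by rewrite oppr_ge0 c0.
by rewrite bc -sumrN; apply: eq_bigr => a _; rewrite scaleNr.
Qed.

Lemma sum_delta a (d : int) : a \in B ->
  \sum_(x <- B) (if x == a then d else 0) *: x = d *: a.
Proof.
move=> aB; rewrite (bigD1_seq a) //= eqxx big1 ?addr0 // => x /negPf ->.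
by rewrite scale0r.
Qed.

Lemma simple_pos a : a \in B -> pos_root a.
Proof.
move=> aB; exists (fun x => if x == a then 1 else 0).
  by rewrite sum_delta // scale1r.
by move=> x _; case: ifP.
Qed.

(** The reflection in [a] changes only the coordinate at [a]. If it destroys positivity, all other
    coordinates of [b] are both nonnegative and nonpositive, so [b] is a multiple of [a]; the
    multiple need not be 1 when the datum is not reduced. *)
Lemma pos_refl_multiple a b : a \in B -> b \in RR -> pos_root b ->
  ~ pos_root (b *m refl a) -> refl b = refl a.
Proof.
move=> aB hb [c bc c0].
have hba : b *m refl a \in RR by rewrite row_refl refl_roots // BR.
move=> /(pos_root_opp hba)[c' bc' c0'].
suff e : b = c a *: a.
  by rewrite e (refl_multiple (BR aB)) // -e.
have cc' x : x \in B -> c x - (if x == a then pairing b (coroot a) else 0) = - c' x.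
  apply: (coords_inj (c := fun x => c x - (if x == a then _ else 0))
    (c' := fun x => - c' x)).
  under eq_bigr do rewrite scalerBl.
  under [RHS]eq_bigr do rewrite scaleNr.
  by rewrite sumrB sumrN -bc' -bc sum_delta // opprK row_refl.
rewrite {1}bc (bigD1_seq a) //= big_seq_cond big1 ?addr0 // => x /andP[xB xa].
have := cc' x xB; rewrite (negPf xa) subr0 => cx.
suff -> : c x = 0 by rewrite scale0r.
by apply/eqP; rewrite eq_le c0 // cx oppr_le0 c0'.
Qed.

(** The exchange condition. At the letter where the image of [b] stops being positive, that image
    has the same reflection as the letter; moving [refl b] through the preceding letters by
    [refl_conj] cancels this letter. *)
Lemma refl_word_exchange b t : b \in RR -> {subset t <= B} -> pos_root b ->
  ~ pos_root (b *m refl_word t) ->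
  exists t', [/\ {subset t' <= B}, size t = (size t').+1 &
    refl b *m refl_word t = refl_word t'].
Proof.
elim: t b => [|a t IH] b hb tB pb /=; first by rewrite mulmx1.
have aB : a \in B by apply: tB; rewrite mem_head.
have tB' : {subset t <= B} by move=> x xt; apply: tB; rewrite in_cons xt orbT.
have ra := BR aB; have rba : b *m refl a \in RR by rewrite row_refl refl_roots.
rewrite mulmxA => nb.
have [pba|nba] := pselect (pos_root (b *m refl a)).
  have [t' [t'B st e]] := IH _ rba tB' pba nb.
  exists (a :: t'); split => [x||] /=; last 2 first.
  - by rewrite st.
  - rewrite -e refl_conj // ?refl_invmx //; last exact: weyl_refl.
    by rewrite -!mulmxA (mulmxA (refl a) (refl a)) refl_invol // mul1mx.
  - by rewrite in_cons => /orP[/eqP ->//|]; apply: t'B.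
exists t; split => //.
by rewrite (pos_refl_multiple aB hb pb nba) mulmxA refl_invol // mul1mx.
Qed.

Lemma dominant_exists : exists h, forall a, a \in B -> 0 < pairing a h.
Proof.
case: hB => _ _ iB _; have [d d0 [h hh]] := dual_vector uB iB (fun=> 1).
by exists h => a /hh ->; rewrite mulr1.
Qed.

(** Induction on the height [<b, h>], for [h] positive on [B]. A simple [a] with [<b, coroot a> > 0]
    lowers it: either [b *m refl a] is not positive and [refl b] is [refl a], or [refl b] is the
    conjugate by [refl a] of the reflection in a lower root. *)
Lemma pos_refl_eq_word b : b \in RR -> pos_root b ->
  exists2 t, {subset t <= B} & refl b = refl_word t.
Proof.
have [h h_dom] := dominant_exists.
have [m] := ubnP `|pairing b h|%N.
elim: m b => [//|m IH] b /ltnSE bm hb pb.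
have h_pos x : pos_root x -> 0 <= pairing x h.
  move=> [c xc c0]; rewrite xc pairing_suml big_seq; apply: sumr_ge0 => a aB.
  by rewrite pairingZl mulr_ge0 ?c0 // ltW ?h_dom.
(* Otherwise every simple root pairs nonpositively with [coroot b], and expanding [b] in [B] gives
   [<b, coroot b> <= 0] instead of 2. *)
have [a aB ba] : exists2 a, a \in B & 0 < pairing b (coroot a).
  case: (pb) => c bc c0.
  have [[a [aB a0]]|no] :=
    pselect (exists a, a \in B /\ 0 < pairing a (coroot b)).
    by exists a => //; rewrite pairing_coroot_gt0 // BR.
  suff : pairing b (coroot b) <= 0 by rewrite pairing_coroot.
  rewrite {1}bc pairing_suml big_seq; apply: sumr_le0 => a aB.
  rewrite pairingZl mulr_ge0_le0 ?c0 // leNgt; apply/negP => a0.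
  by case: no; exists a.
have [pba|nba] := pselect (pos_root (b *m refl a)); last first.
  exists [:: a]; first by move=> x; rewrite inE => /eqP ->.
  by rewrite /= mulmx1; apply: pos_refl_multiple.
have ra := BR aB; have rba : b *m refl a \in RR by rewrite row_refl refl_roots.
have [|t tB e] := IH (b *m refl a) _ rba pba.
  apply: leq_trans bm.
  have : pairing (b *m refl a) h < pairing b h.
    rewrite row_refl pairingDl pairingNl pairingZl gtrDl oppr_lt0.
    by rewrite mulr_gt0 // h_dom.
  have := h_pos _ pba; have := h_pos _ pb.
  by case: (pairing _ h) => // ?; case: (pairing _ h).
exists (a :: rcons t a).
  move=> x; rewrite in_cons mem_rcons in_cons => /or3P[/eqP->|/eqP->|/tB] //.
rewrite /= -cats1 refl_word_cat /= mulmx1 -e refl_conj //; last exact: weyl_refl.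
by rewrite refl_invmx // !mulmxA refl_invol // mul1mx -mulmxA refl_invol // mulmx1.
Qed.

Lemma weyl_eq_refl_word g : weyl Phi g ->
  exists2 t, {subset t <= B} & g = refl_word t.
Proof.
have hr b : b \in RR -> exists2 t, {subset t <= B} & refl b = refl_word t.
  move=> hb; have [pb|nb] := pselect (pos_root b); first exact: pos_refl_eq_word.
  have rb : -1 *: b \in RR.
    by rewrite scaleN1r -root_refl_opp // row_refl refl_roots.
  rewrite -(refl_multiple hb rb) scaleN1r.
  by apply: pos_refl_eq_word; [rewrite -scaleN1r|apply: pos_root_opp].
elim=> [|s v [b /= hb <-] _ [t tB ->]|s v [b /= hb <-] _ [t tB ->]].
- by exists [::].
- have [t' tB' ->] := hr b hb; exists (t' ++ t); last by rewrite refl_word_cat.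
  by move=> x; rewrite mem_cat => /orP[/tB'|/tB].
- rewrite refl_invmx //.
  have [t' tB' ->] := hr b hb; exists (t' ++ t); last by rewrite refl_word_cat.
  by move=> x; rewrite mem_cat => /orP[/tB'|/tB].
Qed.

(** * Parabolic subgroups as stabilizers *)

Section Stabilizer.
Variable J : seq 'rV[int]_r.
Hypothesis JB : {subset J <= B}.

Lemma face_weyl g : mx_generated (refls J) g -> weyl Phi g.
Proof.
have sJ s : refls J s -> refls RR s.
  by move=> [a /= aJ <-]; exists a => //; apply/BR/JB.
elim=> [|s v /sJ Ss _|s v /sJ Ss _]; [exact: Gen_one|exact: Gen_mul|exact: Gen_inv].
Qed.

(** Induction on the length of a word for [g]. A first letter in [J] fixes [lam] and is split off.
    For a first letter [a] outside [J], invariance makes the value of [a *m refl_word t] on [lam]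
    negative, so this root is not positive and the exchange condition gives a word shorter by two
    letters. *)
Lemma face_stabilizer (lam : 'cV[int]_r) g :
  (forall a, a \in B -> if a \in J then pairing a lam = 0 else 0 < pairing a lam) ->
  weyl Phi g -> (forall b, b \in RR -> pairing (b *m g) lam = pairing b lam) ->
  mx_generated (refls J) g.
Proof.
move=> hlam /weyl_eq_refl_word[t + ->]; have [m] := ubnP (size t).
elim: m t => [//|m IH] [|a t] /ltnSE tm tB /= fix_lam; first exact: Gen_one.
have aB : a \in B by apply: tB; rewrite mem_head.
have ra := BR aB.
have tB' : {subset t <= B} by move=> x xt; apply: tB; rewrite in_cons xt orbT.
have := hlam a aB; case: ifPn => aJ la.
  apply: Gen_mul; first by exists a.
  apply: IH => // b hb.
  have rba : b *m refl a \in RR by rewrite row_refl refl_roots.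
  have := fix_lam _ rba; rewrite mulmxA -(mulmxA b) refl_invol // mulmx1 => ->.
  by rewrite row_refl pairingDl pairingNl pairingZl la mulr0 subr0.
have [|t' [t'B st e]] := @refl_word_exchange a t ra tB' (simple_pos aB).
  have := fix_lam a ra; rewrite mulmxA root_refl_opp // mulNmx => fa [c ec c0].
  move: la; rewrite -fa ec pairingNl oppr_gt0 ltNge => /negP[].
  rewrite pairing_suml big_seq; apply: sumr_ge0 => x xB.
  rewrite pairingZl mulr_ge0 ?c0 //.
  by have := hlam x xB; case: ifP => _ => [->|/ltW].
rewrite e; apply: IH => //.
  by rewrite -ltnS -st ltnW.
by move=> b hb; rewrite -e fix_lam.
Qed.

(** Take [lam] zero on [J] and positive on the rest of [B], and carry it to a row vector by the
    equivariant [root_form]. That map need not be injective, but [root_form lam] determines the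
    pairings of [lam] with the roots, which is all that [face_stabilizer] asks. *)
Lemma parabolic_fixer : exists mu : 'rV[int]_r, forall g, weyl Phi g ->
  (mx_generated (refls J) g <-> mu *m g = mu).
Proof.
case: hB => _ _ iB _.
have [d d0 [lam hlam]] := dual_vector uB iB (fun a => (a \notin J)%:R).
exists (root_form lam) => g wg; split => [|mug].
  elim=> {g wg} [|s v [a /= aJ <-] _ IH|s v [a /= aJ <-] _ IH].
  - by rewrite mulmx1.
  - have ra : a \in RR by apply/BR/JB.
    rewrite mulmxA -{1}(refl_invmx ra) root_form_mul; last exact: weyl_refl.
    by rewrite refl_col hlam ?JB // aJ mulr0 scale0r subr0.
  - have ra : a \in RR by apply/BR/JB.
    rewrite mulmxA root_form_mul; last exact: weyl_refl.
    by rewrite refl_col hlam ?JB // aJ mulr0 scale0r subr0.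
apply: (face_stabilizer (lam := lam)) => // [a aB|b hb].
  rewrite hlam //; by case: (a \in J); rewrite /= ?mulr0n ?mulr0 ?mulr1n ?mulr1.
have e : root_form (g *m lam) = root_form lam.
  by rewrite -root_form_mul // -{1}mug -mulmxA weyl_invr // mulmx1.
apply/(mulIf (lt0r_neq0 (coroot_norm_gt0 hb))).
by rewrite pairing_mulmx -!root_form_coroot // e.
Qed.

(* If the product of the reflections in independent roots [a_i] fixes [x], then
   [x] differs from itself by a combination of the [a_i]. *)
Lemma refl_word_fixed t (x : 'rV[int]_r) : uniq t -> {subset t <= B} ->
  x *m refl_word t = x -> forall a, a \in t -> x *m @refl Phi a = x.
Proof.
move=> ut tB.
(* Each letter [a] subtracts a multiple of [a]. The first coefficient is [<z, coroot a>] and the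
   others are those for [z *m refl a]; when the first vanishes this vector is [z] again, so the
   induction applies to [z]. *)
have sumE : forall s, uniq s -> {subset s <= B} -> forall z : 'rV[int]_r,
    exists2 c : 'rV[int]_r -> int, z *m refl_word s = z - \sum_(a <- s) c a *: a &
      (forall a, a \in s -> c a = 0) -> forall a, a \in s -> z *m @refl Phi a = z.
  elim=> [|a s IH] us sB z /=.
    by exists (fun=> 0) => //; rewrite big_nil mulmx1 subr0.
  case/andP: us => as_ us.
  have sB' : {subset s <= B} by move=> y ys; apply: sB; rewrite in_cons ys orbT.
  have [c cE c0] := IH us sB' (z *m refl a).
  exists (fun u => if u == a then pairing z (coroot a) else c u).
    rewrite mulmxA cE row_refl big_cons eqxx -addrA -opprD; congr (_ - (_ + _)).
    apply: eq_big_seq => y ys; case: eqP => // ya.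
    by rewrite -ya ys in as_.
  move=> h; have za : z *m @refl Phi a = z.
    have := h a (mem_head _ _); rewrite eqxx row_refl => ->.
    by rewrite scale0r subr0.
  move=> y; rewrite in_cons => /orP[/eqP -> //|ys].
  have hc u : u \in s -> c u = 0.
    move=> us'; have := h u; rewrite in_cons us' orbT => /(_ isT).
    by case: eqP => // ua; rewrite -ua us' in as_.
  by have := c0 hc y ys; rewrite za.
have [c cE c0] := sumE t ut tB x; rewrite cE => /eqP.
rewrite subr_eq addrC -subr_eq subrr eq_sym => /eqP s0; apply: c0 => a at_.
case: hB => _ _ iB _.
(* Independence concerns sums over all of [B], so the coefficients are extended by 0 outside [t]. *)
have := iB (fun a => if a \in t then c a else 0).
rewrite (bigID (mem t)) /= [X in _ + X]big1 ?addr0; last first.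
  by move=> y /negPf ->; rewrite scale0r.
rewrite -big_filter (perm_big t); last first.
  apply: uniq_perm => //; first exact: filter_uniq.
  move=> y; rewrite mem_filter; case: (boolP (y \in t)) => //= /tB ->//.
rewrite big_seq; under eq_bigr => y -> do [].
rewrite -big_seq => /(_ s0 a (tB _ at_)).
by rewrite at_.
Qed.

End Stabilizer.
End Base.

(** * Full cycles *)

Definition adjacent_tperm (m j : nat) : 'S_m.+1 := tperm (inord j) (inord j.+1).

Definition adjacent_tperms (m : nat) : seq 'S_m.+1 :=
  [seq adjacent_tperm m j | j <- iota 0 m].

Lemma adjacent_tpermsP m (s : 'S_m.+1) :
  reflect (exists j j' : 'I_m.+1, j' = j.+1 :> nat /\ s = tperm j j')
    (s \in adjacent_tperms m).
Proof.
apply: (iffP mapP) => [[j + ->]|[j [j' [e ->]]]].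
  rewrite mem_iota /= add0n => jm.
  by exists (inord j), (inord j.+1); rewrite !inordK ?ltnS // ltnW.
exists (val j) => //; first by rewrite mem_iota /= add0n -ltnS -e ltn_ord.
by rewrite /adjacent_tperm -e !inord_val.
Qed.

Lemma adjacent_tperms_uniq m : uniq (adjacent_tperms m).
Proof.
rewrite map_inj_in_uniq ?iota_uniq // => i j.
rewrite !mem_iota /= !add0n => im jm /permP /(_ (inord i)).
rewrite /adjacent_tperm tpermL;
case: tpermP => [/(congr1 val)|/(congr1 val)|_ _].
- by rewrite /= !inordK // ltnS // ltnW.
- move=> /= e /(congr1 val) /= e'; move: e e'.
  rewrite !inordK ?ltnS // 1?ltnW // => -> /eqP.
  by rewrite -addn2 -{2}[j]addn0 eqn_add2l.
- move=> /(congr1 val) /= /eqP; rewrite !inordK ?ltnS // 1?ltnW //.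
  by rewrite -{2}[i]addn0 -addn1 eqn_add2l.
Qed.

(** Products of permutations apply the left factor first, so each new factor carries the image of 0
    one step up and sends the next point, fixed until then, one step down. *)
Lemma prod_adjacent_tpermE m d (i : 'I_m.+1) : (d <= m)%N ->
  (\prod_(0 <= j < d) adjacent_tperm m j)%g i =
  inord (if i == 0 :> nat then d else if (i <= d)%N then i.-1 else i).
Proof.
elim: d => [|d IH] dm.
  rewrite big_nil perm1; apply: val_inj => /=.
  case: eqP => [->|i0]; first by rewrite inordK.
  rewrite leqn0; case: eqP => // _; by rewrite inord_val.
rewrite big_nat_recr //= permM IH ?(ltnW dm) // /adjacent_tperm.
have dm' : (d < m.+1)%N by rewrite ltnS ltnW.
case: (posnP i) => [_|i0]; first by rewrite tpermL.
have im := ltn_ord i.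
case: (ltngtP i d.+1) => id.
- rewrite -ltnS id tpermD //; apply/eqP => /(congr1 val) /=;
    rewrite !inordK // ?(leq_ltn_trans (leq_pred _)) //; by lia.
- rewrite leqNgt (ltnW id) /= tpermD //; apply/eqP => /(congr1 val) /=;
    rewrite !inordK //; by lia.
- by rewrite id ltnn /= tpermR.
Qed.

(* [c] is conjugated by [j |-> c^(m - j) 0] to the cycle [j |-> j - 1], which
   is the product of the adjacent transpositions in increasing order. *)
Lemma full_cycle_conj m (c : 'S_m.+1) :
  (forall x y, y \in porbit c x) ->
  exists s : 'S_m.+1, c = ((\prod_(t <- adjacent_tperms m) t) ^ s)%g.
Proof.
move=> hc.
have po : #|porbit c ord0| = m.+1.
  by rewrite -[RHS]card_ord; apply: eq_card => y; rewrite hc.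
have uc := uniq_traject_porbit c ord0; rewrite po in uc.
pose f (j : 'I_m.+1) := (c ^+ (m - j))%g ord0.
have fI : injective f.
  move=> i j; rewrite /f !permX => e; apply: val_inj => /=.
  have [im jm] := (ltn_ord i, ltn_ord j); rewrite !ltnS in im jm.
  have nt k : (k <= m)%N -> iter k c ord0 = nth ord0 (traject c ord0 m.+1) k.
    by move=> km; rewrite nth_traject.
  move: e; rewrite !nt ?leq_subr // => /eqP.
  rewrite nth_uniq ?size_traject ?ltnS ?leq_subr //.
  by move=> /eqP e; rewrite -(subKn im) e subKn.
exists (perm fI); apply/permP => x; set s := perm fI.
rewrite -[x](permKV s) permJ; move: (s^-1 x)%g => {x} i.
have e : iota 0 m = index_iota 0 m by rewrite /index_iota subn0.
rewrite big_map e prod_adjacent_tpermE //.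
rewrite !permE /f; case: (posnP i) => [i0|i0].
  (* The adjacent product sends 0 to [m]. On the other side [f 0] is [c^m 0], and one more [c]
     returns to 0, which is [f m]. *)
  rewrite inordK // subnn perm1 i0 subn0 -permM -expgSr permX.
  by have := iter_porbit c ord0; rewrite po.
have im := ltn_ord i; rewrite -ltnS im inordK; last by lia.
by rewrite -permM -expgSr; have -> : (m - i.-1 = (m - i).+1)%N by lia.
Qed.

(** Each factor is treated by [full_cycle_conj], which needs [n i] to be a successor; the lists are
    concatenated and the conjugators collected componentwise. Transpositions are nontrivial, so
    those placed in different factors stay distinct. *)
Lemma full_cycles_conj (k : nat) (n : 'I_k -> nat) (c : sym_prod n) :
  (forall i, (0 < n i)%N) -> full_cycles c ->
  exists (L : seq (sym_prod n)) (s : sym_prod n),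
    [/\ uniq L, forall t, t \in L <-> simple_transpositions t
      & c = ((\prod_(t <- L) t) ^ s)%g].
Proof.
move=> n0 hc.
have hq q (d : 'S_q) : (0 < q)%N -> (forall x y, y \in porbit d x) ->
    exists Ls : seq 'S_q * 'S_q, [/\ uniq Ls.1,
      forall t, t \in Ls.1 <-> exists j j' : 'I_q, j' = j.+1 :> nat /\ t = tperm j j'
      & d = ((\prod_(t <- Ls.1) t) ^ Ls.2)%g].
  case: q d => // q d _ /full_cycle_conj[s sE].
  exists (adjacent_tperms q, s); split => //=; first exact: adjacent_tperms_uniq.
  by move=> t; split => /adjacent_tpermsP.
have [F hF] : exists F : forall i, seq 'S_(n i) * 'S_(n i), forall i,
    [/\ uniq (F i).1, forall t, t \in (F i).1 <->
          exists j j' : 'I_(n i), j' = j.+1 :> nat /\ t = tperm j j'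
      & c i = ((\prod_(t <- (F i).1) t) ^ (F i).2)%g].
  exists (fun i => sval (cid (hq _ (c i) (n0 i) (hc i)))) => i.
  exact: svalP (cid (hq _ (c i) (n0 i) (hc i))).
have t1 i t : t \in (F i).1 -> t != 1%g.
  case: (hF i) => _ Lt _ /Lt[j [j' [jj ->]]]; apply/eqP => /permP /(_ j).
  by rewrite tpermL perm1 => e; move: jj; rewrite e => /n_Sn.
exists [seq dfung1 t | i <- index_enum 'I_k, t <- (F i).1], [ffun i => (F i).2].
split.
- apply: allpairs_uniq_dep; first exact: index_enum_uniq.
    by move=> i _; case: (hF i).
  move=> _ _ /allpairsPdep[i [t [_ tL ->]]] /allpairsPdep[i' [t' [_ tL' ->]]] /= e.
  have [ii|ii] := eqVneq i i'; last first.
    have /ffunP/(_ i) := e; rewrite dfung1_id dfung1_dflt 1?eq_sym // => t1'.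
    by have := t1 _ _ tL; rewrite t1' eqxx.
  subst i'; congr Tagged; have /ffunP/(_ i) := e.
  by rewrite !dfung1_id.
- move=> t; split.
    move=> /allpairsPdep[i [u [_ uL ->]]].
    by case: (hF i) => _ /(_ u) [/(_ uL)[j [j' [jj ->]]] _] _; exists i, j, j'.
  move=> [i [j [j' [jj ->]]]]; apply/allpairsPdep; exists i, (tperm j j').
  split => //; first by rewrite mem_index_enum.
  by case: (hF i) => _ Lt _; apply/Lt; exists j, j'.
- rewrite big_allpairs_dep /=.
  have dprod i (L : seq 'S_(n i)) : (\prod_(t <- L) dfung1 t)%g =
      dfung1 (\prod_(t <- L) t)%g :> sym_prod n.
    by apply/esym/big_morph; [exact: dfung1_morphM|exact: morph1].
  under eq_bigr => i _ do rewrite dprod.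
  apply/ffunP => i.
  rewrite /conjg !mulg_ffun invg_ffun prodg_ffun ffunE.
  rewrite (big_only1 i) ?dfung1_id //; last first.
    by move=> j ji _; rewrite dfung1_dflt.
  by case: (hF i).
Qed.

(** * The centralizer of a Coxeter element *)

Section Centralizer.
Variables (Phi : root_datum) (W : matgroup (rk Phi)).
Variable simple : set 'M[int]_(rk Phi).
Hypothesis hW : parabolic W simple.

Lemma parabolic_fixed_row : exists nu : 'rV[int]_(rk Phi),
  forall g, weyl Phi g -> (W g <-> nu *m g = nu).
Proof.
case: hW => B [J [u [hB JB wu WE _]]].
have [mu muP] := parabolic_fixer hB JB; have wV := mg_inv wu.
exists (mu *m invmx u) => g wg.
have wc : weyl Phi (invmx u *m g *m u).
  by apply: (@mg_mul _ (weyl Phi)) => //; apply: (@mg_mul _ (weyl Phi)).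
have gE : u *m (invmx u *m g *m u) *m invmx u = g.
  by rewrite !mulmxA weyl_invr // mul1mx -mulmxA weyl_invr // mulmx1.
split.
  rewrite WE => -[w gw <-].
  have ww := face_weyl hB JB gw.
  have /(muP _ ww) e := gw.
  by rewrite !mulmxA -(mulmxA mu) weyl_invl // mulmx1 e.
move=> e; rewrite WE; exists (invmx u *m g *m u) => //.
apply/(muP _ wc); rewrite !mulmxA e.
by rewrite -mulmxA weyl_invl // mulmx1.
Qed.

Variables (k : nat) (n : 'I_k -> nat).
Hypothesis n_gt0 : forall i, (0 < n i)%N.
Variables (phi : sym_prod n -> 'M[int]_(rk Phi)) (c : sym_prod n).
Hypotheses (hphi : coxeter_iso W simple phi) (hc : full_cycles c).

(** Up to conjugation by [phi s] and [u], [phi c] is a product of reflections in distinct simple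
    roots. By [refl_word_fixed] a vector fixed by the product is fixed by each of them, hence by all
    of [W]. *)
Lemma coxeter_element_fixed (x : 'rV[int]_(rk Phi)) :
  x *m phi c = x -> forall z, W z -> x *m z = x.
Proof.
case: hphi => phiM phiI phiW phiS.
case: hW => B [J [u [hB JB wu WE SE]]] xc.
have JR a : a \in J -> a \in roots Phi by move=> /JB; case: hB => _ + _ _; apply.
have phi_in t : W (phi t) by rewrite -phiW; exists t.
have phi1 : phi 1%g = 1%:M.
  have u1 := mg_unit (phi_in 1%g).
  by apply: (can_inj (mulKmx u1)); rewrite -phiM mulg1 mulmx1.
have [L [s [uL LP cE]]] := full_cycles_conj n_gt0 hc.
have rootE t : exists a, t \in L -> a \in J /\ phi t = u *m refl a *m invmx u.
  have [tL|] := boolP (t \in L); last by exists 0.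
  have : simple (phi t) by rewrite -phiS; exists t => //; apply/LP.
  by rewrite SE => -[_ [a aJ <-] <-]; exists a.
(* [A t] is a simple root in [J] whose reflection, conjugated by [u], is [phi t]; injectivity of
   [phi] makes these roots distinct. *)
have [A AP] := choice rootE.
have uA : uniq (map A L).
  rewrite map_inj_in_uniq // => t t' /AP[_ e] /AP[_ e'] tt'.
  by apply: phiI; rewrite e e' tt'.
have prodE : phi (\prod_(t <- L) t)%g = u *m refl_word (map A L) *m invmx u.
  have : {subset L <= L} by [].
  elim: {-2}L => [|t L' IH] sL /=.
    by rewrite big_nil phi1 mulmx1 weyl_invr.
  have [_ e] := AP t (sL _ (mem_head _ _)).
  rewrite big_cons phiM e IH; last by move=> y yL; apply: sL; rewrite in_cons yL orbT.
  by rewrite !mulmxA -(mulmxA _ (invmx u) u) weyl_invl // mulmx1.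
(* Since [c] is [s^-1 P s] with [P] the product over [L], fixing [x] by [phi c] amounts to fixing
   this [y] by the word of simple reflections. *)
pose y := x *m phi s^-1%g *m u.
have yw : y *m refl_word (map A L) = y.
  have -> : refl_word (map A L) = invmx u *m phi (\prod_(t <- L) t)%g *m u.
    by rewrite prodE !mulmxA weyl_invl // mul1mx -mulmxA weyl_invl // mulmx1.
  rewrite /y !mulmxA -(mulmxA _ u) weyl_invr // mulmx1 -(mulmxA x) -phiM.
  have -> : (s^-1 * \prod_(t <- L) t = c * s^-1)%g.
    by rewrite cE /conjg -!mulgA mulgV mulg1.
  by rewrite phiM mulmxA xc.
have yA := @refl_word_fixed Phi B hB (map A L) y uA.
have yJ a : a \in J -> y *m refl a = y.
  move=> aJ; have : simple (u *m refl a *m invmx u).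
    by rewrite SE; exists (refl a) => //; exists a.
  rewrite -phiS => -[t /LP tL]; have [Aj ->] := AP t tL => e.
  have -> : refl a = refl (A t).
    have uu := mg_unit wu; move: e => /(congr1 (mulmx^~ u)).
    by rewrite !mulmxKV // => /(can_inj (mulKmx uu)) ->.
  apply: yA => //; last exact: map_f.
  by move=> _ /mapP[t' /AP[/JB hB' _] ->].
have yg w : mx_generated (refls J) w -> y *m w = y.
  elim=> [|_ w' [a aJ <-] _ IH|_ w' [a aJ <-] _ IH]; first by rewrite mulmx1.
    by rewrite mulmxA yJ.
  by rewrite mulmxA refl_invmx ?JR // yJ.
have xs z : W z -> x *m phi s^-1%g *m z = x *m phi s^-1%g.
  rewrite WE => -[w /yg gw <-].
  rewrite !mulmxA -/y gw /y -mulmxA weyl_invr // mulmx1 //.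
(* [phi s] lies in [W], hence fixes [x *m phi s^-1]; but it sends this vector to [x]. *)
have xE : x = x *m phi s^-1%g.
  by rewrite -{1}[x]mulmx1 -phi1 -(mulVg s) phiM mulmxA xs.
by move=> z Wz; rewrite xE xs.
Qed.

(** Let [nu] be a row vector whose stabilizer is [W]. If [v] commutes with [phi c], then [nu v] is
    fixed by [phi c], hence by [W], so [v W v^-1] fixes [nu]. The same for [x^-1] gives the
    equivalence. *)
Lemma centralizer_coxeter_normalizes x : weyl Phi x ->
  x *m phi c = phi c *m x -> normalizer (weyl Phi) W x.
Proof.
move=> wx xc; have [nu nuP] := parabolic_fixed_row.
have Wsub := parabolic_sub hW.
have Wc : W (phi c) by case: hphi => _ _ <- _; exists c.
have conjW v z : weyl Phi v -> v *m phi c = phi c *m v -> W z ->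
    W (v *m z *m invmx v).
  move=> wv vc Wz; have wz := Wsub _ Wz.
  apply/nuP.
    by apply: (@mg_mul _ (weyl Phi)); [exact: mg_mul|exact: mg_inv].
  have nc : nu *m v *m phi c = nu *m v.
    by rewrite -mulmxA vc mulmxA; have /nuP -> := Wc; last exact: Wsub.
  by rewrite !mulmxA (coxeter_element_fixed nc Wz) -mulmxA weyl_invr // mulmx1.
split => // w; split => [Ww|]; last exact: conjW.
have wV := mg_inv wx.
have vc : invmx x *m phi c = phi c *m invmx x.
  have ux := mg_unit wx; apply: (can_inj (mulKmx ux)).
  by rewrite mulKVmx // mulmxA xc mulmxK.
have := conjW _ _ wV vc Ww; rewrite invmxK !mulmxA weyl_invl // mul1mx.
by rewrite -mulmxA weyl_invl // mulmx1.
Qed.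

End Centralizer.

(** * Torsors *)

Section TorsorGeneralities.
Variable X : topologicalType.
Local Open Scope classical_set_scope.
Implicit Types U V Z : opens X.

Lemma torsor_iso_refl (G : group_sheaf X) (P : torsor G) : torsor_iso P P.
Proof. exact: (torsor_iso_of_map (f := fun U p => p)). Qed.

Lemma torsor_iso_trans (G : group_sheaf X) (P Q T : torsor G) :
  torsor_iso P Q -> torsor_iso Q T -> torsor_iso P T.
Proof.
move=> [f [_ fr fa]] [g [_ gr ga]].
apply: (torsor_iso_of_map (f := fun U p => g U (f U p))).
- by move=> U V h p; rewrite fr gr.
- by move=> U p a; rewrite fa ga.
Qed.

Lemma torsor_iso_sym (G : group_sheaf X) (P Q : torsor G) :
  torsor_iso P Q -> torsor_iso Q P.
Proof.
move=> [f [fb fr fa]].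
have fs U q : exists p, f U p = q.
  by have [g _ gK] := fb U; exists (g q).
pose g U q := sval (cid (fs U q)).
have gK U q : f U (g U q) = q by rewrite /g; case: cid.
have fI U : injective (f U) by apply: bij_inj.
apply: (torsor_iso_of_map (f := g)).
- by move=> U V h q; apply: fI; rewrite fr !gK.
- by move=> U q a; apply: fI; rewrite fa !gK.
Qed.

Definition gsheaf_comp (G H K : group_sheaf X) (psi : gsheaf_hom H K)
  (phi : gsheaf_hom G H) : gsheaf_hom G K.
Proof.
exists (fun U a => psi U (phi U a)).
- by move=> U a b; rewrite !hom_mul.
- by move=> U V h a; rewrite !hom_res.
Defined.

Lemma induce_comp (G H K : group_sheaf X) (phi : gsheaf_hom G H)
  (psi : gsheaf_hom H K) (chi : gsheaf_hom G K) (P : torsor G) :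
  (forall U a, chi U a = psi U (phi U a)) ->
  torsor_iso (induce psi (induce phi P)) (induce chi P).
Proof.
move=> chiE; have [r1 a1] := induce_map phi P.
have [r2 a2] := induce_map psi (induce phi P).
apply: (@induce_uniq _ _ _ chi P (induce psi (induce phi P))
  (fun U p => induced_of psi (P := induce phi P) (induced_of phi p))).
split=> [U V h p|U p a]; first by rewrite r1 r2.
by rewrite a1 a2 chiE.
Qed.

Lemma induce_square (G H H' K : group_sheaf X) (phi : gsheaf_hom G H)
  (psi : gsheaf_hom H K) (phi' : gsheaf_hom G H') (psi' : gsheaf_hom H' K)
  (P : torsor G) :
  (forall U a, psi U (phi U a) = psi' U (phi' U a)) ->
  torsor_iso (induce psi (induce phi P)) (induce psi' (induce phi' P)).
Proof.
move=> e; apply: torsor_iso_trans (torsor_iso_sym _).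
  exact: (induce_comp (chi := gsheaf_comp psi phi)).
exact: induce_comp.
Qed.

Lemma induce_iso (G H : group_sheaf X) (phi : gsheaf_hom G H) (P Q : torsor G) :
  torsor_iso P Q -> torsor_iso (induce phi P) (induce phi Q).
Proof.
move=> [f [_ fr fa]]; apply: torsor_iso_sym.
have [r1 a1] := induce_map phi Q.
apply: (@induce_uniq _ _ _ phi P (induce phi Q) (fun U p => induced_of phi (f U p))).
split=> [U V h p|U p a]; first by rewrite fr r1.
by rewrite fa a1.
Qed.

Lemma induce_id (G : group_sheaf X) (phi : gsheaf_hom G G) (P : torsor G) :
  (forall U a, phi U a = a) -> torsor_iso P (induce phi P).
Proof.
move=> phiE; apply: (@induce_uniq _ _ _ phi P P (fun U p => p)).
by split=> // U p a; rewrite phiE.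
Qed.

(** The class of [p] is equivariant along [phi] after [kappa]; translating it by [h] makes it
    equivariant along [phi], and [induce_uniq] applies. A global section is given here as a
    compatible family. *)
Lemma induce_inner (G H : group_sheaf X) (phi : gsheaf_hom G H)
  (kappa : gsheaf_hom G G) (h : forall U, H U) (P : torsor G) :
  (forall U V (hV : V `<=` U), res hV (h U) = h V) ->
  (forall U a, gmul (phi U (kappa U a)) (h U) = gmul (h U) (phi U a)) ->
  torsor_iso (induce phi (induce kappa P)) (induce phi P).
Proof.
move=> hr hc; have [r1 a1] := induce_map kappa P.
have [r2 a2] := induce_map phi (induce kappa P).
apply: (@induce_uniq _ _ _ phi P (induce phi (induce kappa P))
  (fun U p => @act _ _ (induce phi (induce kappa P)) U
    (induced_of phi (P := induce kappa P) (induced_of kappa p)) (h U))).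
split=> [U V hV p|U p a]; first by rewrite r1 r2 act_res hr.
by rewrite a1 a2 !act_mul hc.
Qed.

Lemma torsor_cover (G : group_sheaf X) (P : torsor G) U :
  exists (I : Type) (V : I -> opens X) (hV : forall i, V i `<=` U)
    (p : forall i, P (V i)), forall x, U x -> exists i, V i x.
Proof.
pose I := {V : opens X | V `<=` U /\ exists p : P V, True}.
have hV (i : I) : sval i `<=` U by case: (svalP i).
pose p (i : I) : P (sval i) := sval (cid (svalP i).2).
exists I, (fun i => sval i), hV, p => x Ux.
have [V Vx [q _]] := locally_nonempty P x.
have h1 : opens_setI U V `<=` U by move=> y [].
have h2 : opens_setI U V `<=` V by move=> y [].
by exists (exist _ (opens_setI U V) (conj h1 (ex_intro _ (res h2 q) Logic.I))).
Qed.

Section Lift.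
Variables (G H K : group_sheaf X) (a : gsheaf_hom G H) (phi : gsheaf_hom H K).
Variables (P : torsor G) (T : torsor H) (Q : torsor K).
Variables (pi : forall U, P U -> T U) (f : forall U, P U -> Q U).
Hypothesis hpi : equivariant_map a pi.
Hypothesis hf : equivariant_map (gsheaf_comp phi a) f.

(* [T] is induced from [P] along [a], so its maps are determined on [P]. *)
Lemma equivariant_lift : exists2 F : forall U, T U -> Q U,
  equivariant_map phi F & forall U p, F U (pi p) = f p.
Proof.
have [pr pa] := hpi; have [fr fa] := hf.
(* Writing [s] as [pi p] times [d] forces the value to be [f p] times [phi d]. The condition is
   imposed on smaller open sets because [P] may have no section over [U]. *)
pose good U (s : T U) (q : Q U) := forall V (h : V `<=` U) (p : P V),
  res h q = act (f p) (phi V (torsor_div (pi p) (res h s))).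
have indep V (p p' : P V) (s : T V) :
    act (f p) (phi V (torsor_div (pi p) s)) =
    act (f p') (phi V (torsor_div (pi p') s)).
  have [g [<- _]] := act_simply_transitive p p'.
  rewrite fa pa act_mul /= -hom_mul; congr (act _ (phi V _)).
  by apply: torsor_div_uniq; rewrite -act_mul torsor_divP.
have exu U (s : T U) : exists! q, good U s q.
  have [I [V [hV [p cov]]]] := torsor_cover P U.
  pose t i := act (f (p i)) (phi _ (torsor_div (pi (p i)) (res (hV i) s))).
  have tE i Z (hi : Z `<=` V i) (hZ : Z `<=` U) (p' : P Z) :
      res hi (t i) = act (f p') (phi Z (torsor_div (pi p') (res hZ s))).
    rewrite /t act_res -fr -hom_res res_torsor_div -pr (res_comp _ _ hZ).
    exact: indep.
  have [|q [hq uq]] := glue hV cov (s := t).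
    move=> i j Z hi hj; have hZ := subset_trans hi (hV i).
    by rewrite (tE i Z hi hZ (res hi (p i))) (tE j Z hj hZ (res hi (p i))).
  exists q; split.
    move=> Z hZ p'; apply: sheaf_sep => x Zx; have [i ix] := cov x (hZ x Zx).
    exists (opens_setI Z (V i)) => //.
    have h1 : opens_setI Z (V i) `<=` Z by move=> y [].
    have h2 : opens_setI Z (V i) `<=` V i by move=> y [].
    have h3 := subset_trans h1 hZ.
    exists h1; rewrite (res_comp _ _ h3) -(res_comp (hV i) h2 h3) hq.
    rewrite (tE i _ h2 h3 (res h1 p')) act_res -fr -hom_res res_torsor_div -pr.
    by rewrite (res_comp _ _ h3).
  by move=> q' gq'; apply: uq => i; rewrite (gq' _ (hV i) (p i)).
pose F U s := sval (cid (exu U s)).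
have FP U s : good U s (F U s) by rewrite /F; case: cid => q [].
have FU U s q : good U s q -> F U s = q.
  by rewrite /F; case: cid => q' [] /= _ uq /uq.
exists F.
  split.
    move=> U V h s; apply: FU => Z hZ p.
    have hZU := subset_trans hZ h.
    by rewrite (res_comp _ _ hZU) (FP U s Z hZU p) (res_comp _ _ hZU).
  move=> U s b; apply: FU => Z hZ p.
  rewrite act_res (FP U s Z hZ p) act_mul -hom_res -hom_mul.
  congr (act _ (phi Z _)); apply/esym/torsor_div_uniq.
  by rewrite -act_mul torsor_divP act_res.
move=> U p; apply: FU => Z hZ p'; rewrite -fr -pr.
have [g [e _]] := act_simply_transitive p' (res hZ p).
rewrite -e fa pa; congr (act _ (phi Z _)); apply/esym.
exact: torsor_div_uniq.
Qed.

End Lift.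

(** * Fibre products of torsors *)

Section FibreProduct.
Variables (G H K L : group_sheaf X).
Variables (i : gsheaf_hom G H) (p : gsheaf_hom G K).
Variables (p' : gsheaf_hom H L) (i' : gsheaf_hom K L).
Hypothesis comm : forall U a, p' U (i U a) = i' U (p U a).
Hypothesis cart : forall U (b : H U) (c : K U), p' U b = i' U c ->
  exists! a, i U a = b /\ p U a = c.
Hypothesis surj : forall U (d : L U), exists b, p' U b = d.
Variables (Q : torsor H) (S : torsor K) (T : torsor L).
Variables (mu : forall U, Q U -> T U) (nu : forall U, S U -> T U).
Hypotheses (hmu : equivariant_map p' mu) (hnu : equivariant_map i' nu).

Definition fibre_sect U : Type := {x : Q U * S U | mu x.1 = nu x.2}.

Lemma fibre_sect_eq U (x y : fibre_sect U) :
  (sval x).1 = (sval y).1 -> (sval x).2 = (sval y).2 -> x = y.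
Proof.
case: x y => [[x1 x2] hx] [[y1 y2] hy] /= e1 e2; subst y1 y2.
by congr exist; apply: Prop_irrelevance.
Qed.

Definition fibre_res U V (h : V `<=` U) (x : fibre_sect U) : fibre_sect V.
Proof.
exists (res h (sval x).1, res h (sval x).2) => /=.
by rewrite hmu.1 hnu.1 (svalP x).
Defined.

Definition fibre_sheaf : sheaf X.
Proof.
apply: (@Sheaf X fibre_sect fibre_res).
- by move=> U h s; apply: fibre_sect_eq; rewrite /= res_id.
- by move=> U V Z hV hZ h s; apply: fibre_sect_eq; rewrite /= res_comp.
- move=> U I V hV cov s comp.
  have [|q [hq uq]] := glue hV cov (s := fun j => (sval (s j)).1).
    by move=> j j' Z h h'; have /(congr1 (fun x => (sval x).1)) := comp j j' Z h h'.
  have [|t [ht ut]] := glue hV cov (s := fun j => (sval (s j)).2).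
    by move=> j j' Z h h'; have /(congr1 (fun x => (sval x).2)) := comp j j' Z h h'.
  have e : mu q = nu t.
    apply: sheaf_sep => x /cov[j jx]; exists (V j) => //; exists (hV j).
    by rewrite -hmu.1 -hnu.1 hq ht (svalP (s j)).
  exists (exist _ (q, t) e); split.
    by move=> j; apply: fibre_sect_eq => /=; [exact: hq|exact: ht].
  move=> z hz; apply: fibre_sect_eq => /=.
    by apply: uq => j; rewrite -hz.
  by apply: ut => j; rewrite -hz.
Defined.

Definition fibre_act U (x : fibre_sect U) (a : G U) : fibre_sect U.
Proof.
exists (act (sval x).1 (i U a), act (sval x).2 (p U a)) => /=.
by rewrite hmu.2 hnu.2 (svalP x) comm.
Defined.

(** Simple transitivity combines the unique translations in [Q] and [S] through [cart]. For local
    sections, [surj] supplies a translation moving a section of [Q] over the image of a section of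
    [S]. *)
Definition fibre_torsor : torsor G.
Proof.
apply: (@Torsor X G fibre_sheaf fibre_act).
- by move=> U x; apply: fibre_sect_eq; rewrite /= hom_one act_one.
- by move=> U x a b; apply: fibre_sect_eq; rewrite /= act_mul hom_mul.
- by move=> U V h x a; apply: fibre_sect_eq; rewrite /= act_res hom_res.
- move=> U x y.
  have [b [hb ub]] := act_simply_transitive (sval x).1 (sval y).1.
  have [c [hc uc]] := act_simply_transitive (sval x).2 (sval y).2.
  have bc : p' U b = i' U c.
    apply: (@act_inj _ _ _ _ (mu (sval x).1)).
    by rewrite -hmu.2 hb (svalP y) (svalP x) -hnu.2 hc.
  have [a [[ab ac] ua]] := cart bc; exists a; split.
    by apply: fibre_sect_eq => /=; rewrite ?ab ?ac.
  move=> a' e; apply: ua; split.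
    by apply/esym/ub; rewrite -e.
  by apply/esym/uc; rewrite -e.
- move=> x; have [V1 V1x [q _]] := locally_nonempty Q x.
  have [V2 V2x [t _]] := locally_nonempty S x.
  pose V := opens_setI V1 V2.
  have h1 : V `<=` V1 by move=> y [].
  have h2 : V `<=` V2 by move=> y [].
  exists V => //.
  have [b hb] := surj (torsor_div (mu (res h1 q)) (nu (res h2 t))).
  have e : mu (act (res h1 q) b) = nu (res h2 t).
    by rewrite hmu.2 hb torsor_divP.
  by exists (exist _ (act (res h1 q) b, res h2 t) e).
Defined.

Lemma fibre_torsorP :
  torsor_iso (induce i fibre_torsor) Q /\ torsor_iso (induce p fibre_torsor) S.
Proof.
split; apply: torsor_iso_sym.
  by apply: (@induce_uniq _ _ _ i fibre_torsor Q (fun U x => (sval x).1)).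
by apply: (@induce_uniq _ _ _ p fibre_torsor S (fun U x => (sval x).2)).
Qed.

End FibreProduct.
End TorsorGeneralities.

(** * Automorphisms of a torsor on the circle *)

Lemma locally_constant_real (R : realType) (T : Type) (f : R -> T) :
  (forall t, exists2 e : R, 0 < e & forall u, `|u| < e -> f (t + u) = f t) ->
  forall t t', f t = f t'.
Proof.
move=> lc t t'; pose A := [set s | f s = f t]%classic.
have oA (B : set T) : open ((f @^-1` B)%classic : set R).
  rewrite openE => s /= Bs; have [e e0 he] := lc s.
  apply/nbhs_ballP; exists e => //= u; rewrite /ball /= => us.
  by rewrite -[u](subrKC s) he // distrC.
have cR : connected (@setT R) by apply/connected_intervalP; move=> ? ? ? ? ?.
have AT : A = setT.
  apply: cR; first by exists t.
  - by exists A; [exact: (oA [set x | x = f t]%classic)|rewrite setTI].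
  - exists A; last by rewrite setTI.
    by rewrite -[A]setCK; apply: open_closedC; exact: (oA [set x | x <> f t]%classic).
by have /esym : A t' by rewrite AT.
Qed.

Section Monodromy.
Variables (R : realType) (l : R) (hl : 0 < l) (r : nat).
Variables (W W' : matgroup r) (hWW : (W `<=` W')%classic).
Variables (tau : torsor (const_sheaf (circle l) W)) (w : 'M[int]_r).
Hypothesis tau_w : has_monodromy tau w.
Local Notation ci := (const_incl hWW (circle l)).
Local Open Scope classical_set_scope.

Variable gam : forall U : opens (circle l), tau U -> const_sheaf (circle l) W' U.
Hypothesis gam_res : forall (U V : opens (circle l)) (h : V `<=` U) (s : tau U),
  gam (res h s) = res h (gam s).
Hypothesis gam_act : forall (U : opens (circle l)) (s : tau U)
  (b : const_sheaf (circle l) W U),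
  gmul (ci U b) (gam (act s b)) = gmul (gam s) (ci U b).

(* [gam] is an automorphism of the [W']-torsor induced from [tau], written in
   local sections of [tau]. *)
Lemma gauge_constant : exists x, [/\ W' x, x *m w = w *m x &
  forall (U : opens (circle l)) (s : tau U) (y : pts U), exists2 d, W d &
    sval (gam s) y = invmx d *m x *m d].
Proof.
have [sig [sig_res sig_w]] := tau_w.
have pi_arc (t s : R) : `|s - t| < l / 4 -> arc l t (\pi_(circle l) s)%qT.
  by move=> st; exists s.
have pi_arc0 t : arc l t (\pi_(circle l) t)%qT.
  by apply: pi_arc; rewrite subrr normr0 divr_gt0.
(* [gam] read on the universal cover in the trivialization [sig]. Sections with nearby centres
   agree, so [xi] is locally constant on the line, hence constant. *)
pose xi t : 'M[int]_r := sval (gam (sig t)) (exist _ _ (pi_arc0 t)).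
have xiE (t s : R) (ts : arc l t (\pi_(circle l) s)%qT) : `|s - t| < l / 4 ->
    sval (gam (sig t)) (exist _ _ ts) = xi s.
  move=> st; pose V := opens_setI (arc l t) (arc l s).
  have h1 : V `<=` arc l t by move=> y [].
  have h2 : V `<=` arc l s by move=> y [].
  have e : res h1 (sig t) = res h2 (sig s).
    apply: sig_res; rewrite distrC; apply: lt_trans st _.
    by rewrite ltr_pM2l // ltf_pV2 ?posrE // ltr_nat.
  have Vs : V (\pi_(circle l) s)%qT by split.
  have := congr1 (fun g : tau V => sval (gam g) (exist _ _ Vs)) e.
  rewrite !gam_res /= /xi /incl /= => e'.
  rewrite (Prop_irrelevance ts (h1 _ Vs)) e'.
  by rewrite (Prop_irrelevance (h2 _ Vs) (pi_arc0 s)).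
have xi_loc t : exists2 e : R, 0 < e & forall u, `|u| < e -> xi (t + u) = xi t.
  have [_ lc] := svalP (gam (sig t)).
  have [V Vt hV] := lc (exist _ _ (pi_arc0 t)).
  have [e e0 he] := pi_circle_near Vt.
  exists (Num.min e (l / 4)); first by rewrite lt_min e0 divr_gt0.
  move=> u; rewrite lt_min => /andP[ue ul].
  have tu : `|t + u - t| < l / 4 by rewrite addrAC subrr add0r.
  rewrite -(xiE t (t + u) (pi_arc _ _ tu) tu) hV //=.
  exact: he.
have xi_cst := locally_constant_real xi_loc.
pose x := xi 0.
have sigE t (y : pts (arc l t)) : sval (gam (sig t)) y = x.
  case: y => y hy; have [s st sy] : arc_set t y by [].
  by subst y; rewrite xiE // /x; apply: xi_cst.
exists x; split.
- by have [inW _] := svalP (gam (sig 0)); apply: inW.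
(* After one turn, [sig (0 + l)] is [sig 0] translated by [w], while [gam] has the value [x] on
   both; [gam_act] then reads [w x = x w]. *)
- pose V := opens_setI (arc l 0) (arc l (0 + l)).
  have h1 : V `<=` arc l 0 by move=> y [].
  have h2 : V `<=` arc l (0 + l) by move=> y [].
  have V0 : V (\pi_(circle l) 0)%qT.
    split; first exact: pi_arc0.
    have -> : (\pi_(circle l) 0)%qT = (\pi_(circle l) (0 + l))%qT.
      by apply/pi_circleP; exists 1; rewrite mul1r.
    exact: pi_arc0.
  have [g gw e] := sig_w 0 V h1 h2.
  have := gam_act (res h1 (sig 0)) g.
  rewrite -e !gam_res
    => /(congr1 (fun f : const_sheaf (circle l) W' V =>
         sval f (exist _ _ V0))) /=.
  by rewrite !gw !sigE.
- move=> U s [y Uy].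
  have [t yt] : exists t, y = (\pi_(circle l) t)%qT.
    by exists (generic_quotient.repr y); rewrite reprK.
  subst y; pose V := opens_setI U (arc l t).
  have h1 : V `<=` U by move=> z [].
  have h2 : V `<=` arc l t by move=> z [].
  have Vt : V (\pi_(circle l) t)%qT by split.
  (* A section differs from [sig t] by some [b] with values in [W], and [gam_act] conjugates the
     value [x] by [b]. *)
  have [b [e _]] := act_simply_transitive (res h2 (sig t)) (res h1 s).
  have [hb _] := svalP b.
  exists (sval b (exist _ _ Vt)) => //.
  have := gam_act (res h2 (sig t)) b.
  rewrite e !gam_res
    => /(congr1 (fun f : const_sheaf (circle l) W' V =>
         sval f (exist _ _ Vt))) /=.
  rewrite sigE /incl /= (Prop_irrelevance (h1 _ Vt) Uy) => E.
  have ub := mg_unit (hb (exist _ _ Vt)).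
  by rewrite -mulmxA -E mulKmx.
Qed.

End Monodromy.

(** * Tropical bundles *)

Section Tropical.
Variables (R : realType) (l : R) (r : nat).
Variables (W W' : matgroup r) (hWW : (W `<=` W')%classic).
Local Open Scope classical_set_scope.
Implicit Types U V : opens (circle l).
Local Notation G := (trop_sheaf l W).
Local Notation G' := (trop_sheaf l W').
Local Notation ci := (const_incl hWW (circle l)).
Local Notation ti := (trop_incl l hWW).

Lemma trop_square U (a : G U) :
  trop_proj l W' U (ti U a) = ci U (trop_proj l W U a).
Proof. exact: fsect_eq. Qed.

Lemma trop_incl_inj U (a b : G U) : ti U a = ti U b -> a = b.
Proof.
move=> /(congr1 (fun g : G' U => sval g)) e; apply: fsect_eq => x.
exact: (congr1 (fun f => f x) e).
Qed.

Lemma trop_incl_lift U (b : G' U) : (forall x, W (sval b x).2) ->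
  exists a, ti U a = b.
Proof.
case: b => b [hb [bW' lb]] /= bW.
have hb' : @trop_pred R l r W U b by split.
by exists (exist _ b hb'); apply: fsect_eq.
Qed.

Definition const_lift U (d : const_sheaf (circle l) W' U) : G' U.
Proof.
exists (fun x => (0, sval d x)).
by split; [move=> i x _; exact: harmonic_at_cst|exact: (svalP d)].
Defined.

(** A section of [G'] comes from [G] as soon as its linear part lies in [W]. This is the cartesian
    square needed for the fibre product of bundles. *)
Lemma trop_cart U (b : G' U) (c : const_sheaf (circle l) W U) :
  trop_proj l W' U b = ci U c ->
  exists! a, ti U a = b /\ trop_proj l W U a = c.
Proof.
move=> e; have cE x : (sval b x).2 = sval c x.
  by have := congr1 (fun f : const_sheaf (circle l) W' U => sval f x) e.
have [a aE] : exists a, ti U a = b.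
  by apply: trop_incl_lift => x; rewrite cE; case: (svalP c).
exists a; split; last by move=> a' [a'E _]; apply: trop_incl_inj; rewrite aE.
split=> //; apply: fsect_eq => x; rewrite -cE.
by rewrite -aE.
Qed.

Lemma trop_proj_surj U (d : const_sheaf (circle l) W' U) :
  exists b, trop_proj l W' U b = d.
Proof. by exists (const_lift d); apply: fsect_eq. Qed.

Definition trop_const n (hn : W' n) U : G' U.
Proof.
exists (fun _ => (0, n)); split; first by move=> i x _; exact: harmonic_at_cst.
by split=> //; apply: lc_cst.
Defined.

Lemma trop_const_conj n (hn : normalizer W' W n) U (a : G U) :
  gmul (ti U (trop_conj l hn U a)) (trop_const hn.1 U) =
  gmul (trop_const hn.1 U) (ti U a).
Proof.
have un := mg_unit hn.1.
apply: fsect_eq => x; rewrite /= /sd_mul /sd_conj /=.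
by rewrite mulmx0 addr0 add0r mulmxKV.
Qed.

(** In [G'] the conjugation by [n] is inner, through the constant section [(0, n)]. Hence inducing
    to [G'] is constant on the orbits of the normalizer. *)
Lemma induce_trop_conj n (hn : normalizer W' W n) (P : bundle l W) :
  torsor_iso (induce ti (induce (trop_conj l hn) P)) (induce ti P).
Proof.
apply: (@induce_inner _ _ _ ti (trop_conj l hn) (trop_const hn.1)).
  by move=> U V hV; apply: fsect_eq.
exact: trop_const_conj.
Qed.

Lemma normalizer_one : normalizer W' W 1%:M.
Proof.
split; first exact: mg_one.
by move=> w; rewrite invmx1 mul1mx mulmx1.
Qed.

Lemma normalizer_inv n : normalizer W' W n -> normalizer W' W (invmx n).
Proof.
move=> [W'n nW]; have un := mg_unit W'n; split; first exact: mg_inv.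
move=> w; rewrite -nW invmxK !mulmxA mulmxV // mul1mx mulmxK //.
Qed.

Lemma invmx_mul (m n : 'M[int]_r) : m \in unitmx -> n \in unitmx ->
  invmx (m *m n) = invmx n *m invmx m.
Proof.
move=> um un; have umn : m *m n \in unitmx by rewrite unitmx_mul um.
by apply: (can_inj (mulKmx umn)); rewrite mulmxV // mulmxA (mulmxK un) mulmxV.
Qed.

Lemma normalizer_mul m n :
  normalizer W' W m -> normalizer W' W n -> normalizer W' W (m *m n).
Proof.
move=> [W'm mW] [W'n nW]; split; first exact: mg_mul.
move=> w; rewrite (invmx_mul (mg_unit W'm) (mg_unit W'n)).
have -> : m *m n *m w *m (invmx n *m invmx m) =
    m *m (n *m w *m invmx n) *m invmx m by rewrite !mulmxA.
by rewrite mW nW.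
Qed.

Lemma trop_conj_comp m n (hm : normalizer W' W m) (hn : normalizer W' W n)
  (hmn : normalizer W' W (m *m n)) (P : bundle l W) :
  torsor_iso (induce (trop_conj l hm) (induce (trop_conj l hn) P))
    (induce (trop_conj l hmn) P).
Proof.
apply: induce_comp => U a; apply: fsect_eq => x; rewrite /= /sd_conj /=.
rewrite (invmx_mul (mg_unit hm.1) (mg_unit hn.1)) intmxM.
by rewrite !mulmxA.
Qed.

Lemma trop_conj_one (h1 : normalizer W' W 1%:M) (P : bundle l W) :
  torsor_iso P (induce (trop_conj l h1) P).
Proof.
apply: induce_id => U a; apply: fsect_eq => x; rewrite /= /sd_conj.
rewrite intmx1 invmx1 !mul1mx mulmx1.
by case: (sval a x).
Qed.

Lemma iso_class_eq (P Q : bundle l W) :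
  torsor_iso P Q -> iso_class P = iso_class Q.
Proof.
move=> PQ; apply: funext => T; apply: propext; split.
  by apply: torsor_iso_trans; apply: torsor_iso_sym.
exact: torsor_iso_trans.
Qed.

(* [(n m)_* P] is [n_* (m_* P)]. *)
Lemma coset_act_conj m (hm : normalizer W' W m) (P Q : bundle l W) n :
  normalizer W' W n -> torsor_iso Q (induce (trop_conj l hm) P) ->
  coset_act W' [set n *m w | w in mg_set W] (iso_class Q) =
  coset_act W' [set (n *m m) *m w | w in mg_set W] (iso_class P).
Proof.
move=> hn QP; have um := mg_unit hm.1; have un := mg_unit hn.1.
apply: funext => T; apply: propext; split.
  move=> [n' [hn' [[w Ww nw] [Q' QQ' QT]]]].
  exists (n' *m m), (normalizer_mul hn' hm); split.
    (* [(n w) m = (n m) (m^-1 w m)], and [m] normalizes [W]. *)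
    exists (invmx m *m w *m m).
      by have [_ h] := normalizer_inv hm; rewrite -[X in _ *m X]invmxK; apply/h.
    by rewrite -nw !mulmxA mulmxK.
  exists P; first exact: torsor_iso_refl.
  apply: torsor_iso_trans QT.
  apply: torsor_iso_trans (torsor_iso_sym (trop_conj_comp hn' hm _ _)) _.
  apply: induce_iso; apply: torsor_iso_trans QQ'; exact: torsor_iso_sym.
move=> [n' [hn' [[w Ww nw] [P' PP' P'T]]]].
have hmV := normalizer_inv hm.
have hn2 := normalizer_mul hn' hmV.
exists (n' *m invmx m), hn2; split.
  exists (m *m w *m invmx m); first by have [_ h] := hm; apply/h.
  by rewrite -nw !mulmxA.
exists Q; first exact: torsor_iso_refl.
apply: torsor_iso_trans P'T.
have hn3 : normalizer W' W (n' *m invmx m *m m) by apply: normalizer_mul.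
apply: torsor_iso_trans (induce_iso _ QP) _.
apply: torsor_iso_trans (trop_conj_comp hn2 hm hn3 P) _.
have e : n' = n' *m invmx m *m m by rewrite mulmxKV.
move: hn3; rewrite -e => hn3; rewrite (Prop_irrelevance hn3 hn').
exact: induce_iso.
Qed.

Lemma coset_orbit_sub m (hm : normalizer W' W m) (P Q : bundle l W) c :
  torsor_iso Q (induce (trop_conj l hm) P) ->
  coset_orbit W' (iso_class Q) c -> coset_orbit W' (iso_class P) c.
Proof.
move=> QP [_ [n hn <-] <-].
exists [set (n *m m) *m w | w in mg_set W].
  by exists (n *m m) => //; apply: normalizer_mul.
by rewrite -(coset_act_conj hn QP).
Qed.

(** One inclusion is [coset_orbit_sub]; the other is the same statement with the roles exchanged, as
    [P] is the conjugate of [Q] by [m^-1]. *)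
Lemma coset_orbit_eq m (hm : normalizer W' W m) (P Q : bundle l W) :
  torsor_iso Q (induce (trop_conj l hm) P) ->
  coset_orbit W' (iso_class Q) = coset_orbit W' (iso_class P).
Proof.
move=> QP; apply: funext => c; apply: propext.
split; first exact: coset_orbit_sub QP.
apply: (@coset_orbit_sub _ (normalizer_inv hm)).
apply: torsor_iso_trans (torsor_iso_sym (induce_iso _ QP)).
have h1 : normalizer W' W (invmx m *m m).
  by apply: normalizer_mul => //; apply: normalizer_inv.
apply: torsor_iso_trans (torsor_iso_sym (trop_conj_comp _ hm h1 _)).
move: h1; rewrite mulVmx ?(mg_unit hm.1) // => h1.
exact: trop_conj_one.
Qed.

(** By [induce_trop_conj] all bundles in the orbit induce isomorphic [G']-bundles, so the value is
    one isomorphism class; the trivial coset shows that the class of [P] itself contributes. *)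
Lemma natural_map_orbit (P : bundle l W) :
  natural_map hWW (coset_orbit W' (iso_class P)) = iso_class (induce ti P).
Proof.
apply: funext => Q; apply: propext; split.
  move=> [_ [_ [n hn <-] <-] [P' [n' [hn' [_ [P0 PP0 P0P']]]] P'Q]].
  apply: torsor_iso_trans P'Q; apply: torsor_iso_trans (induce_iso _ P0P').
  apply: torsor_iso_trans (torsor_iso_sym (induce_trop_conj hn' _)).
  exact: induce_iso.
move=> PQ; have h1 := normalizer_one.
exists (coset_act W' [set 1%:M *m w | w in mg_set W] (iso_class P)).
  by exists [set 1%:M *m w | w in mg_set W] => //; exists 1%:M.
exists P => //; exists 1%:M, h1; split.
  by exists 1%:M; [exact: mg_one|rewrite mulmx1].
exists P; first exact: torsor_iso_refl.
exact/torsor_iso_sym/trop_conj_one.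
Qed.

Lemma induced_type (P : bundle l W) (tau : torsor (const_sheaf (circle l) W)) :
  torsor_iso (induce (trop_proj l W) P) tau ->
  torsor_iso (induce (trop_proj l W') (induce ti P)) (induce ci tau).
Proof.
move=> Pt; apply: torsor_iso_trans (induce_iso ci Pt).
by apply: induce_square => U a; apply: trop_square.
Qed.

Lemma reduction_exists (Q : bundle l W')
  (tau : torsor (const_sheaf (circle l) W)) :
  torsor_iso (induce (trop_proj l W') Q) (induce ci tau) ->
  exists P : bundle l W, torsor_iso (induce ti P) Q /\
    torsor_iso (induce (trop_proj l W) P) tau.
Proof.
move=> [f [_ fr fa]]; have [r1 a1] := induce_map (trop_proj l W') Q.
have hmu : equivariant_map (trop_proj l W') (Q := induce ci tau)
    (fun U q => f U (induced_of (trop_proj l W') q)).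
  by split=> [U V h q|U q a]; rewrite ?r1 ?a1 ?fr ?fa.
exists (fibre_torsor (fun U a => trop_square a) (@trop_cart) (@trop_proj_surj)
  hmu (induce_map ci tau)).
exact: fibre_torsorP.
Qed.

(** * Reductions inducing isomorphic bundles *)

Section Injectivity.
Hypothesis hl : 0 < l.
Variables (tau : torsor (const_sheaf (circle l) W)) (w : 'M[int]_r).
Hypothesis tau_w : has_monodromy tau w.
Hypothesis cent : forall x, W' x -> x *m w = w *m x -> normalizer W' W x.

(** Both bundles map into [E], by [iota] and [j]. Their images differ by the automorphism [gam] of
    the [W']-torsor, locally a [W]-conjugate of a constant [x]; translating [j] by [x^-1] brings its
    image into that of [iota]. *)
Lemma reduction_unique (P1 P2 : bundle l W) :
  torsor_iso (induce (trop_proj l W) P1) tau ->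
  torsor_iso (induce (trop_proj l W) P2) tau ->
  torsor_iso (induce ti P1) (induce ti P2) ->
  exists x, exists hx : normalizer W' W x,
    torsor_iso P2 (induce (trop_conj l hx) P1).
Proof.
move=> [f1 [_ f1r f1a]] [f2 [_ f2r f2a]] [F [_ Fr Fa]].
pose pr := trop_proj l W.
have to_tau (P : bundle l W) (f : forall U, induce pr P U -> tau U) :
    (forall U V (h : V `<=` U) p, f V (res h p) = res h (f U p)) ->
    (forall U p a, f U (act p a) = act (f U p) a) ->
    equivariant_map pr (fun U p => f U (induced_of pr (P := P) p)).
  move=> fr fa; have [r1 a1] := induce_map pr P.
  by split=> [U V h p|U p a]; rewrite ?r1 ?a1 ?fr ?fa.
have := to_tau _ _ f1r f1a; have := to_tau _ _ f2r f2a.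
set pi2 := fun U p => f2 U _; set pi1 := fun U p => f1 U _ => hpi2 hpi1.
pose E := induce ti P2; pose T := induce ci tau.
pose iota U (p : P2 U) : E U := induced_of ti p.
have hiota : equivariant_map ti iota := induce_map ti P2.
pose j U (p : P1 U) : E U := F U (induced_of ti p).
have hj : equivariant_map ti j.
  have [r1 a1] := induce_map ti P1.
  by split=> [U V h p|U p a]; rewrite /j ?r1 ?a1 ?Fr ?Fa.
pose nu U (s : tau U) : T U := induced_of ci s.
have hnu : equivariant_map ci nu := induce_map ci tau.
(* [eta] identifies the [W']-torsor of [E] with [T] so that [P2] maps to the standard copy [nu] of
   [tau]. The next map [al] is the copy of [tau] in [T] coming from [P1], and [gam] compares the
   two. *)
have [eta heta etaE] : exists2 eta : forall U, E U -> T U,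
    equivariant_map (trop_proj l W') eta &
    forall U p, eta U (iota U p) = nu U (pi2 U p).
  apply: (equivariant_lift hiota); split=> [U V h p|U p a].
    by rewrite hpi2.1 hnu.1.
  by rewrite hpi2.2 hnu.2 -trop_square.
have [al hal alE] : exists2 al : forall U, tau U -> T U,
    equivariant_map ci al & forall U p, al U (pi1 U p) = eta U (j U p).
  apply: (equivariant_lift hpi1); split=> [U V h p|U p a].
    by rewrite hj.1 heta.1.
  by rewrite hj.2 heta.2 trop_square.
pose gam U (s : tau U) := torsor_div (nu U s) (al U s).
have gam_res U V (h : V `<=` U) (s : tau U) : gam V (res h s) = res h (gam U s).
  by rewrite /gam hnu.1 hal.1 res_torsor_div.
have gam_act U (s : tau U) (b : const_sheaf (circle l) W U) :
    gmul (ci U b) (gam U (act s b)) = gmul (gam U s) (ci U b).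
  apply: (@act_inj _ _ _ _ (nu U s)); rewrite -!act_mul -hnu.2.
  by rewrite !torsor_divP hal.2.
have [x [W'x xw xP]] := gauge_constant hl tau_w gam_res gam_act.
have hx := cent W'x xw; exists x, hx.
have hxV := normalizer_inv hx; have ux := mg_unit W'x.
pose n U := trop_const hxV.1 U.
have iotaI U (p q : P2 U) : iota U p = iota U q -> p = q.
  have [a [<- _]] := act_simply_transitive p q.
  rewrite hiota.2 => e; suff -> : a = gone _ U by rewrite act_one.
  apply: trop_incl_inj; apply: (@act_inj _ _ _ _ (iota U p)).
  by rewrite -e hom_one act_one.
have local U (p1 : P1 U) (p2 : P2 U) :
    exists q : P2 U, iota U q = act (j U p1) (n U).
  pose g := torsor_div (iota U p2) (j U p1).
  pose b := torsor_div (pi2 U p2) (pi1 U p1).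
  have gE : trop_proj l W' U g = gmul (ci U b) (gam U (pi1 U p1)).
    apply: (@act_inj _ _ _ _ (nu U (pi2 U p2))).
    rewrite -act_mul -hnu.2 torsor_divP -etaE -heta.2 torsor_divP -alE.
    by rewrite torsor_divP.
  have [y|a aE] := trop_incl_lift (b := gmul g (n U)).
    have [d Wd xd] := xP U (pi1 U p1) y.
    have := congr1 (fun f : const_sheaf (circle l) W' U => sval f y) gE.
    rewrite /= xd => ->.
    have Wb : W (sval b y) by case: (svalP b).
    (* The linear part [b d^-1 x d x^-1] is regrouped as an element of [W] times the conjugate by
       [x] of [d], which lies in [W] because [x] normalizes it. *)
    have -> : sval b y *m (invmx d *m x *m d) *m invmx x =
      sval b y *m invmx d *m (x *m d *m invmx x) by rewrite !mulmxA.
    apply: mg_mul; first by apply: mg_mul => //; apply: mg_inv.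
    by have [_ h] := hx; apply/h.
  exists (act p2 a); rewrite hiota.2 aE -act_mul.
  by rewrite torsor_divP.
(* [P2] may have no section over [U], so the preimages are found on a cover; they glue because
   [iota] is injective. *)
have glob U (p1 : P1 U) : exists q : P2 U, iota U q = act (j U p1) (n U).
  have [I [V [hV [p2 cov]]]] := torsor_cover P2 U.
  have lq i : exists q : P2 (V i), iota _ q = act (j _ (res (hV i) p1)) (n _).
    exact: local (p2 i).
  pose s i := sval (cid (lq i)).
  have sE i : iota _ (s i) = act (j _ (res (hV i) p1)) (n _) := svalP (cid (lq i)).
  have nr (Z Z' : opens (circle l)) (h : Z' `<=` Z) : res h (n Z) = n Z'.
    exact: fsect_eq.
  have [|q [hq _]] := glue hV cov (s := s).
    move=> i i' Z hi hi'; apply: iotaI; have hZ := subset_trans hi (hV i).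
    by rewrite !hiota.1 !sE !act_res -!hj.1 !nr !(res_comp _ _ hZ).
  exists q; apply: sheaf_sep => y /cov[i iy]; exists (V i) => //; exists (hV i).
  by rewrite -hiota.1 hq sE act_res -hj.1 nr.
pose Psi U p1 := sval (cid (glob U p1)).
have PsiE U p1 : iota U (Psi U p1) = act (j U p1) (n U) := svalP (cid (glob U p1)).
apply: (@induce_uniq _ _ _ (trop_conj l hx) P1 P2 Psi); split.
  move=> U V h p; apply: iotaI; rewrite hiota.1 !PsiE act_res -hj.1.
  by congr act; apply: fsect_eq.
(* Equivariance along the conjugation: [a x^-1 = x^-1 (x a x^-1)]. *)
move=> U p a; apply: iotaI; rewrite hiota.2 !PsiE hj.2 !act_mul; congr act.
apply: fsect_eq => y; rewrite /= /sd_mul /sd_conj /=.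
by rewrite mulmx0 addr0 add0r !mulmxA -intmxM mulVmx // intmx1 !mul1mx.
Qed.

End Injectivity.
End Tropical.

Theorem theorem4p25 (R : realType) (l : R) (hl : 0 < l) (Phi : root_datum)
  (W : matgroup (rk Phi)) (simple : set 'M[int]_(rk Phi)) (hW : parabolic W simple)
  (k : nat) (n : 'I_k -> nat) (hn : forall i, (0 < n i)%N)
  (phi : sym_prod n -> 'M[int]_(rk Phi)) (hphi : coxeter_iso W simple phi)
  (c : sym_prod n) (hc : full_cycles c)
  (ind : torsor (const_sheaf (circle l) W)) (hind : has_monodromy ind (phi c)) :
  family_bij
    (moduli_quotient (weyl Phi) ind)
    (moduli (induce (const_incl (parabolic_sub hW) (circle l)) ind))
    (natural_map (l := l) (parabolic_sub hW)).
Proof.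
split.
- move=> _ [_ [P Pind <-] <-]; rewrite natural_map_orbit.
  by exists (induce (trop_incl l (parabolic_sub hW)) P) => //; exact: induced_type.
- move=> _ _ [_ [P1 P1ind <-] <-] [_ [P2 P2ind <-] <-].
  rewrite !natural_map_orbit => e.
  have iso12 : torsor_iso (induce (trop_incl l (parabolic_sub hW)) P1)
      (induce (trop_incl l (parabolic_sub hW)) P2).
    have : iso_class (induce (trop_incl l (parabolic_sub hW)) P2)
      (induce (trop_incl l (parabolic_sub hW)) P2) by exact: torsor_iso_refl.
    by rewrite -e.
  have cent x := centralizer_coxeter_normalizes hW hn hphi hc (x := x).
  have [x [hx P21]] := reduction_unique hl hind cent P1ind P2ind iso12.
  by rewrite (coset_orbit_eq P21).
- move=> _ [Q Qind <-]; have [P [PQ Pind]] := reduction_exists Qind.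
  exists (coset_orbit (weyl Phi) (iso_class P)).
    by exists (iso_class P) => //; exists P.
  by rewrite natural_map_orbit; apply: iso_class_eq.
Qed.
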